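(* Let $p$ be an odd prime and let $F$ be a 2-regular graph of order $p$. If $\lambda \equiv 0 \pmod 4$ (with $\lambda \ge 1$), then there exists a 2-factorisation of $\lambda K_p$ into $F$. Moreover, if $F$ satisfies $\nu_3(F) \le \nu_5(F) + \sum_{i=7}^{p} \nu_i(F)$, where $\nu_m(F)$ denotes the number of $m$-cycles in $F$, then such a 2-factorisation of $\lambda K_p$ into $F$ also exists for $\lambda = 3$ and for every integer $\lambda \ge 6$.
   Context: $\lambda K_n$ denotes the complete multigraph of order $n$ with exactly $\lambda$ distinct edges joining each pair of distinct vertices. A 2-factorisation of a (multi)graph into $F$ is a partition of its edge multiset into spanning subgraphs, each isomorphic to the 2-regular graph $F$. *)

(* Defs.v *)
From mathcomp Require Import all_boot.

Set Implicit Arguments.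
Unset Strict Implicit.
Unset Printing Implicit Defensive.

(* Finite loopless multigraphs: edges are distinguishable objects, so parallel
   edges are distinct elements of [edge] with the same pair of ends. *)
Record mgraph := MGraph {
  vert : finType;
  edge : finType;
  ends : edge -> {set vert};
  card_ends : forall e, #|ends e| == 2
}.

Definition graph_order (G : mgraph) : nat := #|vert G|.

Definition simple_graph (G : mgraph) : Prop := injective (@ends G).

Definition vdegree (G : mgraph) (v : vert G) : nat :=
  #|[set e : edge G | v \in ends e]|.

Definition regular_graph (k : nat) (G : mgraph) : Prop :=
  forall v : vert G, vdegree v = k.

Definition isomorphic (G H : mgraph) : Prop :=
  exists (f : vert G -> vert H) (g : edge G -> edge H),
    [/\ bijective f, bijective g & forall e, ends (g e) = f @: ends e].

Definition spanning_subgraph (G : mgraph) (B : {set edge G}) : mgraph :=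
  @MGraph (vert G) {e : edge G | e \in B}
    (fun e => ends (val e)) (fun e => card_ends (val e)).

Definition complete_mgraph (lam n : nat) : mgraph :=
  @MGraph 'I_n ({e : {set 'I_n} | #|e| == 2} * 'I_lam)%type
    (fun e => val e.1) (fun e => valP e.1).

Definition has_factorisation (G F : mgraph) : Prop :=
  exists P : {set {set edge G}},
    partition P [set: edge G] /\
    forall B, B \in P -> isomorphic (spanning_subgraph B) F.

(* [C] is the edge set of a cycle of length [m] of [G]: the ends of its edges,
   counted with multiplicity, are the cyclically consecutive pairs of some
   sequence of [m] distinct vertices. *)
Definition is_cycle (G : mgraph) (m : nat) (C : {set edge G}) : bool :=
  (1 < m) &&
  [exists c : m.-tuple (vert G),
     uniq c && perm_eq [seq ends e | e in C] [seq [set x; next c x] | x <- c]].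

Definition nu (m : nat) (G : mgraph) : nat :=
  #|[set C : {set edge G} | is_cycle m C]|.

(* Main.v *)
Require Import Defs.
From mathcomp Require Import all_boot all_algebra.
From mathcomp Require Import zify.

Set Implicit Arguments.
Unset Strict Implicit.
Unset Printing Implicit Defensive.

(** Identify the vertices of [K_p] with the field [F_p].  If [d] copies of [F]
    decompose the circulant multigraph with differences [w_1, ..., w_d] (all
    nonzero), then the multiples of these copies by [1, ..., (p - 1)/2] decompose
    [d K_p], since each nonzero element is [u w] or [- u w] for exactly one [u].
    So it suffices to decompose one circulant graph with 3 differences and one with
    4 differences, because 3 and 4 generate 3 and all integers from 6 on.

    The circulant graphs are decomposed along the line: segments carrying one, two
    or a few cycles of every factor are glued one after the other, all of them
    having the same pattern of vertices and edges sticking out at their ends.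
    Long cycles are obtained by repeating a periodic middle part.  With differences
    1, 2, 3 there are segments for one cycle of length at least 4, and for a
    triangle together with a cycle of length 5 or at least 7.  With differences
    1, 2, 3, 4 segments take care of an even number of 4-cycles, but an odd number
    can be out of reach: the circulant graph of order 13 has no decomposition into
    copies of three triangles and a 4-cycle.  It is obtained after a trade around
    the origin: the edges
    [{-1, 1}], [{2, 4}], [{-4, -2}] are replaced by [{-4, 4}], [{1, 2}], [{-2, -1}].
    Each new edge is a multiple of an old one and the trade is invariant under
    [x |-> - x], so the multiples of the graph still cover [4 K_p]. *)

(** * Edges of walks and cycles, and gluing of segments *)

Definition walk_edges (T : Type) (x : T) (s : seq T) : seq (T * T) := zip (x :: s) s.

Definition cycle_edges (T : Type) (s : seq T) : seq (T * T) := zip s (rot 1 s).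

Definition cycles_edges (T : Type) (ss : seq (seq T)) : seq (T * T) :=
  flatten (map (@cycle_edges T) ss).

Lemma walk_edges_cat (T : Type) (x : T) s t :
  walk_edges x (s ++ t) = walk_edges x s ++ walk_edges (last x s) t.
Proof. by elim: s x => [|y s IHs] x //=; rewrite /walk_edges /= -!/(walk_edges _ _) IHs. Qed.

Lemma cycle_edges_cons (T : Type) (x : T) s :
  cycle_edges (x :: s) = walk_edges x (s ++ [:: x]).
Proof.
rewrite /cycle_edges rot1_cons /walk_edges -cats1.
suff zipr : forall y, zip (y :: s) (s ++ [:: x]) = zip (y :: s ++ [:: x]) (s ++ [:: x]).
  by rewrite zipr.
by elim: s => [|z s IHs] y //=; rewrite -IHs.
Qed.

Lemma map_walk_edges (T U : Type) (f : T -> U) x s :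
  walk_edges (f x) (map f s) = [seq (f e.1, f e.2) | e <- walk_edges x s].
Proof. by elim: s x => [|y s IHs] x //=; rewrite /walk_edges /= -!/(walk_edges _ _) IHs. Qed.

Lemma map_cycle_edges (T U : Type) (f : T -> U) s :
  cycle_edges (map f s) = [seq (f e.1, f e.2) | e <- cycle_edges s].
Proof.
case: s => [|x s] //.
by rewrite /= !cycle_edges_cons -map_walk_edges map_cat.
Qed.

Lemma map_cycles_edges (T U : Type) (f : T -> U) ss :
  cycles_edges (map (map f) ss) = [seq (f e.1, f e.2) | e <- cycles_edges ss].
Proof.
by elim: ss => [|s ss IH] //; rewrite /cycles_edges /= map_cat map_cycle_edges -IH.
Qed.

Lemma cycles_edges_cat (T : Type) (ss tt : seq (seq T)) :
  cycles_edges (ss ++ tt) = cycles_edges ss ++ cycles_edges tt.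
Proof. by rewrite /cycles_edges map_cat flatten_cat. Qed.

Lemma cycles_edges1 (T : Type) (s : seq T) : cycles_edges [:: s] = cycle_edges s.
Proof. exact: cats0. Qed.

(** Unordered edges are compared as multisets through this normal form, smaller end first, which is
    the form in which [circ_edges] lists them. *)
Definition upair (e : nat * nat) : nat * nat := (minn e.1 e.2, maxn e.1 e.2).

Definition shift_edge (n : nat) (e : nat * nat) : nat * nat := (n + e.1, n + e.2).

Definition shift_cycles (n : nat) (ss : seq (seq nat)) := map (map (addn n)) ss.

Lemma upair_shift n e : upair (shift_edge n e) = shift_edge n (upair e).
Proof. by rewrite /upair /shift_edge /= addn_minr addn_maxr. Qed.

Lemma map_upair_shift n es :
  map upair (map (shift_edge n) es) = map (shift_edge n) (map upair es).
Proof. by rewrite -!map_comp; apply: eq_map => e /=; rewrite upair_shift. Qed.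

Lemma cycles_edges_shift n ss :
  cycles_edges (shift_cycles n ss) = map (shift_edge n) (cycles_edges ss).
Proof. exact: map_cycles_edges. Qed.

Lemma shift_edgeD m n es :
  map (shift_edge m) (map (shift_edge n) es) = map (shift_edge (m + n)) es.
Proof. by rewrite -map_comp; apply: eq_map => e; rewrite /shift_edge /= !addnA. Qed.

Lemma shift_seqD m n (s : seq nat) : map (addn m) (map (addn n) s) = map (addn (m + n)) s.
Proof. by rewrite -map_comp; apply: eq_map => x; rewrite /= addnA. Qed.

Lemma shift_iota m n k : map (addn m) (iota n k) = iota (m + n) k.
Proof. by rewrite iotaDl. Qed.

Definition circ_edges (D : seq nat) (m n : nat) : seq (nat * nat) :=
  flatten [seq [seq (i, i + x) | x <- D] | i <- iota m n].

Lemma circ_edgesD D m n k :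
  circ_edges D m (n + k) = circ_edges D m n ++ circ_edges D (m + n) k.
Proof. by rewrite /circ_edges iotaD map_cat flatten_cat. Qed.

Lemma circ_edges_shift D l m n :
  map (shift_edge l) (circ_edges D m n) = circ_edges D (l + m) n.
Proof.
rewrite /circ_edges iotaDl map_flatten -!map_comp; congr flatten.
by apply: eq_map => i /=; rewrite -map_comp; apply: eq_map => x; rewrite /shift_edge /= addnA.
Qed.

Definition all_edges (d : nat) (B : nat -> seq (nat * nat)) : seq (nat * nat) :=
  flatten [seq map upair (B k) | k <- iota 0 d].

Lemma count_all_edges a d B :
  count a (all_edges d B) = \sum_(k < d) count a (map upair (B k)).
Proof.
rewrite /all_edges count_flatten -map_comp sumnE big_map.
by rewrite -(big_mkord xpredT (fun k => count a (map upair (B k)))) /index_iota subn0.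
Qed.

(* What a block leaves to the next one: beyond its right end it uses the
   vertices [nth [::] pverts k] in the [k]-th factor, and the edges [pedges]. *)
Record pattern := Pattern {
  pdiffs : seq nat;
  pverts : seq (seq nat);
  pedges : seq (nat * nat)
}.

Definition nfactors (X : pattern) := size (pverts X).

(* A block of type [ms] decomposes a segment of [sumn ms] consecutive positions
   into [nfactors X] families of cycles of lengths [ms]; the edges [R] of the
   circulant graph are replaced by [R']. *)
Definition block (X : pattern) (R R' : seq (nat * nat)) (ms : seq nat)
    (B : nat -> seq (seq nat)) : Prop :=
  [/\ forall k, k < nfactors X -> map size (B k) = ms,
      forall k, k < nfactors X ->
        perm_eq (flatten (B k) ++ nth [::] (pverts X) k)
                (iota 0 (sumn ms) ++ map (addn (sumn ms)) (nth [::] (pverts X) k))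
    & perm_eq (all_edges (nfactors X) (fun k => cycles_edges (B k)) ++ pedges X ++ R)
              (circ_edges (pdiffs X) 0 (sumn ms)
                 ++ map (shift_edge (sumn ms)) (pedges X) ++ R')].

(** The decidable form of [block], with a list of factors in place of a function, so that explicit
    segments are checked by computation. *)
Definition blockb X R R' ms (B : seq (seq (seq nat))) : bool :=
  [&& all (fun k => map size (nth [::] B k) == ms) (iota 0 (nfactors X)),
      all (fun k => perm_eq (flatten (nth [::] B k) ++ nth [::] (pverts X) k)
                (iota 0 (sumn ms) ++ map (addn (sumn ms)) (nth [::] (pverts X) k)))
          (iota 0 (nfactors X))
    & perm_eq (all_edges (nfactors X) (fun k => cycles_edges (nth [::] B k)) ++ pedges X ++ R)
              (circ_edges (pdiffs X) 0 (sumn ms)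
                 ++ map (shift_edge (sumn ms)) (pedges X) ++ R')].

Definition tiles X R R' ms := exists B, block X R R' ms B.

Lemma tiles_blockb X R R' ms B : blockb X R R' ms B -> tiles X R R' ms.
Proof.
case/and3P => /allP sz /allP vt ed; exists (nth [::] B); split=> // k kd.
  by apply/eqP/sz; rewrite mem_iota.
by apply: vt; rewrite mem_iota.
Qed.

Lemma tiles_nil X : tiles X [::] [::] [::].
Proof.
exists (fun _ => [::]); split=> //= [k _|].
  by rewrite (eq_map (g := id)) ?map_id // => x; rewrite add0n.
have -> : all_edges (nfactors X) (fun _ => cycles_edges [::]) = [::].
  by rewrite /all_edges; elim: (iota _ _).
rewrite /= !cats0 (eq_map (g := id)) ?map_id //.
by move=> [x y]; rewrite /shift_edge /= !add0n.
Qed.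

(** Counting form of gluing: [s], [s1], [s2] count the pattern at the left end, at the junction and
    at the right end, and the junction terms cancel. *)
Lemma telescope (b c s s1 s2 i i' : nat) :
  b + s = i + s1 -> c + s1 = i' + s2 -> b + c + s = i + i' + s2.
Proof. lia. Qed.

Lemma telescope_edges (b c s s1 s2 i i' r r' : nat) :
  b + (s + r) = i + (s1 + r') -> c + s1 = i' + s2 ->
  b + c + (s + r) = i + i' + (s2 + r').
Proof. lia. Qed.

(** What the first block uses beyond its right end is exactly what the translated second block
    leaves free at its left end. Only the first block may carry a trade, because [R] and [R'] have
    fixed positions and are not translated. *)
Lemma tiles_cat X R R' ms ms' :
  tiles X R R' ms -> tiles X [::] [::] ms' -> tiles X R R' (ms ++ ms').
Proof.
move=> [B [szB vB eB]] [C [szC vC eC]].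
exists (fun k => B k ++ shift_cycles (sumn ms) (C k)); split=> [k kd|k kd|].
- rewrite map_cat szB // -(szC k kd) /shift_cycles -map_comp; congr (_ ++ _).
  by apply: eq_map => s /=; rewrite size_map.
- apply/permP => a; have /permP/(_ a) := vB k kd.
  have /(perm_map (addn (sumn ms)))/permP/(_ a) := vC k kd.
  rewrite flatten_cat sumn_cat /shift_cycles -map_flatten !map_cat iotaD !count_cat.
  by rewrite shift_seqD shift_iota addn0 add0n => vC' vB'; exact: telescope vB' vC'.
- apply/permP => a; have /permP/(_ a) := eB.
  have /(perm_map (shift_edge (sumn ms)))/permP/(_ a) := eC.
  rewrite sumn_cat circ_edgesD !map_cat !count_cat !count_all_edges /=.
  rewrite circ_edges_shift shift_edgeD !addn0 add0n => eC' eB'.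
  rewrite [X in X + _](_ : _ = \sum_(k < nfactors X) count a (map upair (cycles_edges (B k)))
     + count a (map (shift_edge (sumn ms))
        (all_edges (nfactors X) (fun k => cycles_edges (C k))))).
    exact: telescope_edges eB' eC'.
  rewrite count_map count_all_edges -big_split; apply: eq_bigr => k _.
  rewrite cycles_edges_cat cycles_edges_shift map_cat count_cat map_upair_shift.
  by congr (_ + _); rewrite [LHS]count_map.
Qed.

(** * Families of segments of unbounded length *)

(* One factor of a family of blocks.  Lengthening the segment by [c] positions
   puts copies of [front] and [back] around the path [core], and shifts the
   cycles [moving] and the path [turn], which closes the long cycle. *)
Record strand := Strand {
  fixed : seq (seq nat);
  moving : seq (seq nat);
  front : seq nat;
  core : seq nat;
  back : seq nat;
  turn : seq nat
}.

Fixpoint spine (c : nat) (x : strand) (q : nat) : seq nat :=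
  if q is q'.+1 then
    map (addn (c * q')) (front x) ++ spine c x q' ++ map (addn (c * q')) (back x)
  else core x.

Definition strand_cycles c x q : seq (seq nat) :=
  fixed x ++ shift_cycles (c * q) (moving x)
    ++ [:: spine c x q ++ map (addn (c * q)) (turn x)].

(** Passing from [q] to [q.+1] periods replaces these vertices by [new_verts], and [old_edges] by
    [new_edges], all translated by [c * q]; the rest of the strand stays. *)
Definition old_verts x := flatten (moving x) ++ turn x.

Definition new_verts c x :=
  front x ++ back x ++ map (addn c) (flatten (moving x) ++ turn x).

Definition old_edges x :=
  walk_edges (last 0 (core x)) (turn x ++ [:: head 0 (core x)]) ++ cycles_edges (moving x).

Definition new_edges c x :=
  walk_edges (head 0 (front x)) (behead (front x) ++ [:: head 0 (core x)])
   ++ walk_edges (last 0 (core x)) (back x ++ map (addn c) (turn x) ++ [:: head 0 (front x)])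
   ++ cycles_edges (shift_cycles c (moving x)).

(** Each period moves both ends of the path by [c], so that the translated [turn] closes the cycle
    again, and adds exactly [c] vertices to it. *)
Definition strandb c x : bool :=
  [&& core x != [::], front x != [::], back x != [::],
      head 0 (front x) == c + head 0 (core x),
      last 0 (back x) == c + last 0 (core x)
    & size (front x) + size (back x) == c].

Section Strand.

Variables (c : nat) (x : strand).
Hypothesis xok : strandb c x.

Lemma spine_neq0 q : spine c x q != [::].
Proof.
case/and5P: xok => c0 f0 _ _ _; case: q => //= q.
by case: (front x) f0.
Qed.

Lemma head_spine q : head 0 (spine c x q) = c * q + head 0 (core x).
Proof.
case/and5P: xok => c0 f0 b0 /eqP hf _; case: q => [|q] /=; first by rewrite muln0.
by move: f0 hf; case: (front x) => //= y s _ ->; rewrite mulnS; lia.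
Qed.

Lemma last_spine q : last 0 (spine c x q) = c * q + last 0 (core x).
Proof.
case/and5P: xok => c0 f0 b0 _ /andP[/eqP lb _]; case: q => [|q] /=; first by rewrite muln0.
by rewrite !last_cat; move: b0 lb; case/lastP: (back x) => // s y _;
  rewrite map_rcons !last_rcons => ->; rewrite mulnS; lia.
Qed.

Lemma size_spine q : size (spine c x q) = size (core x) + c * q.
Proof.
case/and5P: xok => _ _ _ _ /andP[_ /eqP szc].
elim: q => [|q IHq] /=; first by rewrite muln0 addn0.
by rewrite !size_cat !size_map IHq mulnS; lia.
Qed.

Lemma cycle_edges_spine q :
  cycle_edges (spine c x q ++ map (addn (c * q)) (turn x)) =
  walk_edges (head 0 (spine c x q)) (behead (spine c x q)) ++
  map (shift_edge (c * q))
      (walk_edges (last 0 (core x)) (turn x ++ [:: head 0 (core x)])).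
Proof.
have := spine_neq0 q; have := head_spine q; have := last_spine q.
case: (spine c x q) => // h t /= lt hh _.
rewrite cycle_edges_cons -catA walk_edges_cat lt; congr (_ ++ _).
by rewrite {1}hh -map_walk_edges map_cat.
Qed.

Lemma walk_edges_spineS q :
  walk_edges (head 0 (spine c x q.+1)) (behead (spine c x q.+1)) =
  map (shift_edge (c * q))
      (walk_edges (head 0 (front x)) (behead (front x) ++ [:: head 0 (core x)]))
  ++ walk_edges (head 0 (spine c x q)) (behead (spine c x q))
  ++ map (shift_edge (c * q)) (walk_edges (last 0 (core x)) (back x)).
Proof.
have := spine_neq0 q; have := head_spine q; have := last_spine q.
case/and5P: xok => _ f0 _ _ _ /=; rewrite -!map_walk_edges.
case: (spine c x q) => // h t /= lt hh _.
case: (front x) f0 => // y s _ /=.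
rewrite map_cat /= -hh -lt -walk_edges_cat -[h :: t ++ _]cat1s catA walk_edges_cat.
by rewrite last_cat.
Qed.

Lemma count_strand_edgesS a q :
  count a (cycles_edges (strand_cycles c x q.+1))
    + count a (map (shift_edge (c * q)) (old_edges x)) =
  count a (cycles_edges (strand_cycles c x q))
    + count a (map (shift_edge (c * q)) (new_edges c x)).
Proof.
have hf : head 0 (front x) = c + head 0 (core x) by case/and5P: xok => _ _ _ /eqP.
have lb : last (last 0 (core x)) (back x) = c + last 0 (core x).
  by case/and5P: xok => _ _ + _ /andP[/eqP <- _]; case: (back x).
rewrite /strand_cycles !cycles_edges_cat !cycles_edges_shift.
rewrite !cycles_edges1 !cycle_edges_spine walk_edges_spineS.
rewrite /old_edges /new_edges (walk_edges_cat (last 0 (core x)) (back x)) lb cycles_edges_shift !map_cat !count_cat.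
rewrite !shift_edgeD -mulnSr.
have -> : walk_edges (c + last 0 (core x)) ([seq c + i | i <- turn x] ++ [:: head 0 (front x)])
        = map (shift_edge c) (walk_edges (last 0 (core x)) (turn x ++ [:: head 0 (core x)])).
  by rewrite -map_walk_edges map_cat /= hf.
rewrite shift_edgeD -mulnSr.
lia.
Qed.

Lemma count_strand_vertsS a q :
  count a (flatten (strand_cycles c x q.+1)) + count a (map (addn (c * q)) (old_verts x)) =
  count a (flatten (strand_cycles c x q)) + count a (map (addn (c * q)) (new_verts c x)).
Proof.
rewrite /strand_cycles /old_verts /new_verts !flatten_cat /= !cats0 /shift_cycles.
rewrite -!map_flatten !map_cat !count_cat !shift_seqD -mulnSr; lia.
Qed.

End Strand.

Definition strand0 := Strand [::] [::] [::] [::] [::] [::].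

(** A finite certificate for infinitely many lengths: the shortest member is a block, and what one
    more period gains, minus what it loses, fills [c] new positions and moves the pattern by [c].
    The second condition may be translated, so it is checked for one period only. *)
Definition familyb X c ms m (xs : seq strand) : bool :=
  let n := sumn ms + m in
  [&& blockb X [::] [::] (rcons ms m) [seq strand_cycles c x 0 | x <- xs],
      size xs == nfactors X, all (strandb c) xs,
      all (fun k =>
             perm_eq (new_verts c (nth strand0 xs k) ++ map (addn n) (nth [::] (pverts X) k))
                     (old_verts (nth strand0 xs k) ++ iota n c
                        ++ map (addn (n + c)) (nth [::] (pverts X) k)))
          (iota 0 (nfactors X))
    & perm_eq (all_edges (nfactors X) (fun k => new_edges c (nth strand0 xs k))
                 ++ map (shift_edge n) (pedges X))
              (all_edges (nfactors X) (fun k => old_edges (nth strand0 xs k))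
                 ++ circ_edges (pdiffs X) n c ++ map (shift_edge (n + c)) (pedges X))].

Lemma lengthen (u u' v v' s t t' i j : nat) :
  u' + v = u + v' -> u + s = i + t -> v' + t = v + (j + t') -> u' + s = i + j + t'.
Proof. lia. Qed.

Lemma tiles_family X c ms m xs q :
  familyb X c ms m xs -> tiles X [::] [::] (rcons ms (m + c * q)).
Proof.
rewrite /familyb => /and5P[bl0 /eqP szxs /(all_nthP strand0) xok /allP vok eok].
exists (fun k => strand_cycles c (nth strand0 xs k) q).
have xk k : k < nfactors X -> strandb c (nth strand0 xs k).
  by move=> kd; apply: xok; rewrite szxs.
case/and3P: bl0 => /allP sz0 /allP v0 e0.
have nxk k : k < nfactors X -> nth [::] [seq strand_cycles c x 0 | x <- xs] k
                              = strand_cycles c (nth strand0 xs k) 0.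
  by move=> kd; rewrite (nth_map strand0) ?szxs.
have sumE r : sumn (rcons ms (m + r)) = sumn ms + m + r by rewrite sumn_rcons addnA.
have nE r : [/\ c * r + (sumn ms + m) = sumn ms + m + c * r,
                 c * r + (sumn ms + m + c) = sumn ms + m + c * r + c
               & sumn ms + m + c * r.+1 = sumn ms + m + c * r + c].
  by rewrite mulnS; split; lia.
split=> [k kd|k kd|].
- have := sz0 k; rewrite mem_iota => /(_ kd)/eqP.
  rewrite nxk // /strand_cycles !map_cat muln0 /= catA cats1 => /rcons_inj[<- <-].
  rewrite catA cats1 /shift_cycles -!map_comp !size_cat !size_map (size_spine (xk k kd)).
  congr rcons; last by rewrite addnAC.
  by congr (_ ++ _); apply: eq_map => s /=; rewrite !size_map.
(* The balance of one period, translated by [c * q], is added to the balance for [q] periods. *)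
- elim: q => [|q IHq].
    by have := v0 k; rewrite mem_iota nxk // muln0 addn0 => /(_ kd).
  have [n1 n2 nS] := nE q.
  apply/permP => a; move/permP/(_ a): IHq.
  have := vok k; rewrite mem_iota => /(_ kd)/(perm_map (addn (c * q)))/permP/(_ a).
  have := count_strand_vertsS (xk k kd) a q.
  rewrite !sumE nS !count_cat !map_cat !count_cat !shift_seqD !shift_iota n1 n2.
  rewrite (iotaD 0 (sumn ms + m + c * q) c) count_cat add0n => h1 h2 h3.
  exact: lengthen h1 h3 h2.
- elim: q => [|q IHq].
    move: e0; rewrite muln0 addn0 /all_edges.
    rewrite (_ : map _ _ = [seq map upair (cycles_edges (strand_cycles c (nth strand0 xs k) 0))
                                  | k <- iota 0 (nfactors X)]) //.
    by apply/eq_in_map => k; rewrite mem_iota => kd; rewrite nxk.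
  have [n1 n2 nS] := nE q.
  apply/permP => a; move/permP/(_ a): IHq.
  move: eok => /(perm_map (shift_edge (c * q)))/permP/(_ a).
  rewrite !cats0 !sumE nS !count_cat !map_cat !count_cat !shift_edgeD circ_edges_shift n1 n2.
  rewrite (circ_edgesD _ 0 (sumn ms + m + c * q) c) count_cat add0n !count_map !count_all_edges => h2 h3.
  apply: lengthen h3 h2.
  rewrite -!big_split /=; apply: eq_bigr => k _.
  have := count_strand_edgesS (xk k (ltn_ord k)) (preim upair a) q.
  have preimE : preim (shift_edge (c * q)) (preim upair a)
             =1 preim upair (preim (shift_edge (c * q)) a).
    by move=> e /=; rewrite upair_shift.
  by rewrite !count_map !(eq_count preimE).
Qed.

Lemma tiles_family_mod X c ms m xs n :
  familyb X c ms m xs -> m <= n -> n = m %[mod c] -> tiles X [::] [::] (rcons ms n).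
Proof.
move=> fxs le_mn /eqP; rewrite eqn_mod_dvd // => /dvdnP[q qE].
by rewrite -(subnKC le_mn) qE mulnC; apply: tiles_family fxs.
Qed.

(** * Explicit segments *)

Definition pattern3 : pattern :=
  Pattern [:: 1; 2; 3] [:: [::]; [:: 0; 1]; [:: 0; 2]] [:: (0, 2)].

Definition pattern4 : pattern :=
  Pattern [:: 1; 2; 3; 4] [:: [:: 2]; [:: 1]; [:: 0]; [:: 0; 1; 3]] [:: (1, 3)].

(* The edges [{a, b}] of the trade are replaced by their multiples with respect
   to the origin 6: [{-1, 1}] by [{-4, 4}], [{2, 4}] by [{1, 2}], and [{-4, -2}]
   by [{-2, -1}]. *)
Definition trade_out : seq (nat * nat) := [:: (5, 7); (8, 10); (2, 4)].
Definition trade_in : seq (nat * nat) := [:: (2, 10); (7, 8); (4, 5)].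

(** Triangles are consumed three at a time and 4-cycles two at a time; the other short segments
    absorb the remainders modulo 3 and 2. *)
Lemma tiles4_333 : tiles pattern4 [::] [::] [:: 3; 3; 3].
Proof.
by apply: (@tiles_blockb _ _ _ _
   [:: [:: [:: 0; 1; 4]; [:: 3; 5; 6]; [:: 7; 8; 11]];
      [:: [:: 0; 2; 3]; [:: 4; 5; 8]; [:: 6; 7; 10]];
      [:: [:: 1; 2; 5]; [:: 3; 4; 7]; [:: 6; 8; 9]];
      [:: [:: 2; 4; 6]; [:: 5; 7; 9]; [:: 8; 10; 12]]]); vm_compute.
Qed.

Lemma tiles4_44 : tiles pattern4 [::] [::] [:: 4; 4].
Proof.
by apply: (@tiles_blockb _ _ _ _
   [:: [:: [:: 0; 1; 5; 4]; [:: 3; 6; 10; 7]];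
      [:: [:: 0; 2; 5; 3]; [:: 4; 6; 9; 7]];
      [:: [:: 1; 2; 3; 4]; [:: 5; 6; 7; 8]];
      [:: [:: 2; 4; 8; 6]; [:: 5; 7; 11; 9]]]); vm_compute.
Qed.

Lemma tiles4_344 : tiles pattern4 [::] [::] [:: 3; 4; 4].
Proof.
by apply: (@tiles_blockb _ _ _ _
   [:: [:: [:: 9; 10; 13]; [:: 0; 1; 4; 3]; [:: 5; 6; 7; 8]];
      [:: [:: 8; 9; 12]; [:: 0; 2; 5; 4]; [:: 3; 6; 10; 7]];
      [:: [:: 8; 10; 11]; [:: 1; 2; 3; 5]; [:: 4; 6; 9; 7]];
      [:: [:: 10; 12; 14]; [:: 2; 4; 8; 6]; [:: 5; 7; 11; 9]]]); vm_compute.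
Qed.

Lemma tiles4_3344 : tiles pattern4 [::] [::] [:: 3; 3; 4; 4].
Proof.
by apply: (@tiles_blockb _ _ _ _
   [:: [:: [:: 5; 6; 8]; [:: 7; 10; 11]; [:: 0; 1; 4; 3]; [:: 9; 12; 16; 13]];
      [:: [:: 3; 6; 7]; [:: 8; 9; 11]; [:: 0; 2; 5; 4]; [:: 10; 12; 15; 13]];
      [:: [:: 4; 7; 8]; [:: 6; 9; 10]; [:: 1; 2; 3; 5]; [:: 11; 12; 13; 14]];
      [:: [:: 2; 4; 6]; [:: 5; 7; 9]; [:: 8; 10; 14; 12]; [:: 11; 13; 17; 15]]]); vm_compute.
Qed.

(** The traded segments hold the odd 4-cycle, together with one to three triangles or a 5-cycle. A
    traded edge may lie past the end: here [(8, 10)] is the edge of the pattern translated by 7,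
    which the block does not use although the next block counts it as taken. *)
Lemma tiles4_trade_34 : tiles pattern4 trade_out trade_in [:: 3; 4].
Proof.
by apply: (@tiles_blockb _ _ _ _
   [:: [:: [:: 0; 1; 4]; [:: 3; 5; 9; 6]];
      [:: [:: 0; 2; 3]; [:: 4; 5; 6; 8]];
      [:: [:: 1; 2; 5]; [:: 3; 4; 6; 7]];
      [:: [:: 2; 6; 10]; [:: 4; 5; 8; 7]]]); vm_compute.
Qed.

Lemma tiles4_trade_334 : tiles pattern4 trade_out trade_in [:: 3; 3; 4].
Proof.
by apply: (@tiles_blockb _ _ _ _
   [:: [:: [:: 0; 1; 4]; [:: 8; 9; 12]; [:: 3; 5; 6; 7]];
      [:: [:: 0; 2; 3]; [:: 7; 8; 11]; [:: 4; 5; 9; 6]];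
      [:: [:: 1; 2; 5]; [:: 7; 9; 10]; [:: 3; 4; 8; 6]];
      [:: [:: 2; 6; 10]; [:: 9; 11; 13]; [:: 4; 5; 8; 7]]]); vm_compute.
Qed.

Lemma tiles4_trade_3334 : tiles pattern4 trade_out trade_in [:: 3; 3; 3; 4].
Proof.
by apply: (@tiles_blockb _ _ _ _
   [:: [:: [:: 4; 6; 8]; [:: 7; 9; 10]; [:: 11; 12; 15]; [:: 0; 1; 5; 3]];
      [:: [:: 3; 6; 7]; [:: 8; 9; 12]; [:: 10; 11; 14]; [:: 0; 2; 5; 4]];
      [:: [:: 5; 6; 9]; [:: 7; 8; 11]; [:: 10; 12; 13]; [:: 1; 2; 3; 4]];
      [:: [:: 2; 6; 10]; [:: 9; 11; 13]; [:: 12; 14; 16]; [:: 4; 5; 8; 7]]]); vm_compute.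
Qed.

Lemma tiles4_trade_45 : tiles pattern4 trade_out trade_in [:: 4; 5].
Proof.
by apply: (@tiles_blockb _ _ _ _
   [:: [:: [:: 0; 1; 5; 3]; [:: 4; 6; 7; 11; 8]];
      [:: [:: 0; 2; 3; 4]; [:: 5; 6; 10; 7; 8]];
      [:: [:: 1; 2; 5; 4]; [:: 3; 6; 9; 8; 7]];
      [:: [:: 4; 5; 9; 7]; [:: 2; 6; 8; 12; 10]]]); vm_compute.
Qed.

(** The three families start at lengths 9, 7 and 5, one for each residue modulo 3; they share
    [front], [core] and [back] and differ only in [turn]. The lengths 4 and 6 lie below the start of
    their families. *)
Lemma tiles3_cycle m : 3 < m -> tiles pattern3 [::] [::] (rcons [::] m).
Proof.
move=> hm.
have [->|n4] := eqVneq m 4.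
  by apply: (@tiles_blockb _ _ _ _
    [:: [:: [:: 0; 1; 2; 3]];
      [:: [:: 2; 4; 3; 5]];
      [:: [:: 1; 3; 6; 4]]]); vm_compute.
have [->|n6] := eqVneq m 6.
  by apply: (@tiles_blockb _ _ _ _
    [:: [:: [:: 0; 1; 2; 5; 4; 3]];
      [:: [:: 2; 3; 6; 5; 7; 4]];
      [:: [:: 1; 3; 5; 8; 6; 4]]]); vm_compute.
have [mc|[mc|mc]] : m %% 3 = 0 \/ m %% 3 = 1 \/ m %% 3 = 2 by lia.
- by apply: (@tiles_family_mod _ 3 _ 9
    [:: Strand [::] [::] [:: 6] [:: 3; 0; 1; 2; 4] [:: 5; 7] [:: 5; 8; 7; 6];
        Strand [::] [::] [:: 6; 4] [:: 3; 2; 5] [:: 8] [:: 6; 9; 8; 10; 7; 4];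
        Strand [::] [::] [:: 6; 5] [:: 3; 1; 4] [:: 7] [:: 6; 8; 11; 9; 7; 5]]);
    [vm_compute | lia | lia].
- by apply: (@tiles_family_mod _ 3 _ 7
    [:: Strand [::] [::] [:: 6] [:: 3; 0; 1; 2; 4] [:: 5; 7] [:: 5; 6];
        Strand [::] [::] [:: 6; 4] [:: 3; 2; 5] [:: 8] [:: 8; 6; 7; 4];
        Strand [::] [::] [:: 6; 5] [:: 3; 1; 4] [:: 7] [:: 6; 9; 7; 5]]);
    [vm_compute | lia | lia].
- by apply: (@tiles_family_mod _ 3 _ 5
    [:: Strand [::] [::] [:: 6] [:: 3; 0; 1; 2; 4] [:: 5; 7] [::];
        Strand [::] [::] [:: 6; 4] [:: 3; 2; 5] [:: 8] [:: 4; 6];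
        Strand [::] [::] [:: 6; 5] [:: 3; 1; 4] [:: 7] [:: 7; 5]]);
    [vm_compute | lia | lia].
Qed.

(** In each family the triangle of the first factor travels with the right end of the segment, while
    those of the other two factors stay near its left end. *)
Lemma tiles3_3_cycle m : (m == 5) || (6 < m) -> tiles pattern3 [::] [::] (rcons [:: 3] m).
Proof.
move=> hm.
have [->|n5] := eqVneq m 5.
  by apply: (@tiles_blockb _ _ _ _
    [:: [:: [:: 4; 6; 7]; [:: 0; 1; 2; 5; 3]];
      [:: [:: 2; 3; 4]; [:: 5; 7; 9; 6; 8]];
      [:: [:: 7; 8; 10]; [:: 1; 3; 6; 5; 4]]]); vm_compute.
have [->|n7] := eqVneq m 7.
  by apply: (@tiles_blockb _ _ _ _
    [:: [:: [:: 7; 8; 9]; [:: 0; 1; 2; 4; 5; 6; 3]];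
      [:: [:: 2; 3; 5]; [:: 4; 6; 8; 11; 9; 10; 7]];
      [:: [:: 1; 3; 4]; [:: 5; 7; 6; 9; 12; 10; 8]]]); vm_compute.
have [->|n8] := eqVneq m 8.
  by apply: (@tiles_blockb _ _ _ _
    [:: [:: [:: 8; 9; 10]; [:: 0; 1; 2; 4; 5; 7; 6; 3]];
      [:: [:: 2; 3; 5]; [:: 4; 6; 8; 11; 10; 12; 9; 7]];
      [:: [:: 1; 3; 4]; [:: 5; 6; 9; 11; 13; 10; 7; 8]]]); vm_compute.
have [->|n9] := eqVneq m 9.
  by apply: (@tiles_blockb _ _ _ _
    [:: [:: [:: 9; 10; 11]; [:: 0; 1; 2; 4; 5; 8; 7; 6; 3]];
      [:: [:: 2; 3; 5]; [:: 4; 6; 8; 10; 13; 11; 12; 9; 7]];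
      [:: [:: 1; 3; 4]; [:: 5; 6; 9; 8; 11; 14; 12; 10; 7]]]); vm_compute.
have [mc|[mc|mc]] : m %% 3 = 0 \/ m %% 3 = 1 \/ m %% 3 = 2 by lia.
- by apply: (@tiles_family_mod _ 3 _ 12
    [:: Strand [::] [:: [:: 12; 13; 14]] [:: 10; 8] [:: 7; 5; 4; 2; 1; 0; 3; 6; 9] [:: 12] [:: 10; 11; 8];
        Strand [:: [:: 2; 3; 5]] [::] [:: 10] [:: 7; 4; 6; 8] [:: 9; 11] [:: 9; 11; 13; 16; 14; 15; 12; 10];
        Strand [:: [:: 1; 3; 4]] [::] [:: 10; 9] [:: 7; 6; 5; 8] [:: 11] [:: 10; 13; 15; 17; 14; 11; 12; 9]]);
    [vm_compute | lia | lia].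
- by apply: (@tiles_family_mod _ 3 _ 10
    [:: Strand [::] [:: [:: 10; 11; 12]] [:: 10; 8] [:: 7; 5; 4; 2; 1; 0; 3; 6; 9] [:: 12] [:: 8];
        Strand [:: [:: 2; 3; 5]] [::] [:: 10] [:: 7; 4; 6; 8] [:: 9; 11] [:: 10; 13; 12; 14; 11; 9];
        Strand [:: [:: 1; 3; 4]] [::] [:: 10; 9] [:: 7; 6; 5; 8] [:: 11] [:: 11; 13; 15; 12; 9; 10]]);
    [vm_compute | lia | lia].
- by apply: (@tiles_family_mod _ 3 _ 11
    [:: Strand [::] [:: [:: 11; 12; 13]] [:: 10; 8] [:: 7; 5; 4; 2; 1; 0; 3; 6; 9] [:: 12] [:: 10; 8];
        Strand [:: [:: 2; 3; 5]] [::] [:: 10] [:: 7; 4; 6; 8] [:: 9; 11] [:: 9; 11; 14; 13; 15; 12; 10];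
        Strand [:: [:: 1; 3; 4]] [::] [:: 10; 9] [:: 7; 6; 5; 8] [:: 11] [:: 11; 10; 13; 16; 14; 12; 9]]);
    [vm_compute | lia | lia].
Qed.

Lemma tiles4_cycle m : 4 < m -> tiles pattern4 [::] [::] (rcons [::] m).
Proof.
move=> hm.
have [->|n5] := eqVneq m 5.
  by apply: (@tiles_blockb _ _ _ _
    [:: [:: [:: 0; 1; 4; 7; 3]];
      [:: [:: 0; 2; 3; 6; 4]];
      [:: [:: 1; 2; 4; 3; 5]];
      [:: [:: 2; 5; 4; 8; 6]]]); vm_compute.
have [->|n6] := eqVneq m 6.
  by apply: (@tiles_blockb _ _ _ _
    [:: [:: [:: 0; 1; 4; 8; 5; 3]];
      [:: [:: 0; 2; 3; 7; 5; 4]];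
      [:: [:: 1; 2; 4; 3; 6; 5]];
      [:: [:: 2; 5; 9; 7; 4; 6]]]); vm_compute.
have [->|n7] := eqVneq m 7.
  by apply: (@tiles_blockb _ _ _ _
    [:: [:: [:: 0; 1; 4; 5; 9; 6; 3]];
      [:: [:: 0; 2; 3; 5; 8; 6; 4]];
      [:: [:: 1; 2; 4; 3; 7; 6; 5]];
      [:: [:: 2; 5; 7; 4; 8; 10; 6]]]); vm_compute.
have [mc|[mc|[mc|mc]]] : m %% 4 = 0 \/ m %% 4 = 1 \/ m %% 4 = 2 \/ m %% 4 = 3 by lia.
- by apply: (@tiles_family_mod _ 4 _ 8
    [:: Strand [::] [::] [:: 8; 6; 5] [:: 4; 1; 0; 3; 7] [:: 11] [:: 10; 6; 5];
        Strand [::] [::] [:: 9; 7; 8] [:: 5; 3; 4; 0; 2; 6] [:: 10] [:: 7; 9];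
        Strand [::] [::] [:: 9] [:: 5; 1; 2; 3; 6] [:: 4; 7; 10] [:: 4; 7; 8];
        Strand [::] [::] [:: 8] [:: 4; 2; 5] [:: 7; 6; 9] [:: 7; 11; 9; 6; 8]]);
    [vm_compute | lia | lia].
- by apply: (@tiles_family_mod _ 4 _ 9
    [:: Strand [::] [::] [:: 8; 6; 5] [:: 4; 1; 0; 3; 7] [:: 11] [:: 11; 8; 5; 6];
        Strand [::] [::] [:: 9; 7; 8] [:: 5; 3; 4; 0; 2; 6] [:: 10] [:: 8; 10; 7];
        Strand [::] [::] [:: 9] [:: 5; 1; 2; 3; 6] [:: 4; 7; 10] [:: 7; 9; 8; 4];
        Strand [::] [::] [:: 8] [:: 4; 2; 5] [:: 7; 6; 9] [:: 9; 6; 10; 12; 8; 7]]);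
    [vm_compute | lia | lia].
- by apply: (@tiles_family_mod _ 4 _ 10
    [:: Strand [::] [::] [:: 8; 6; 5] [:: 4; 1; 0; 3; 7] [:: 11] [:: 8; 12; 9; 5; 6];
        Strand [::] [::] [:: 9; 7; 8] [:: 5; 3; 4; 0; 2; 6] [:: 10] [:: 8; 9; 11; 7];
        Strand [::] [::] [:: 9] [:: 5; 1; 2; 3; 6] [:: 4; 7; 10] [:: 7; 9; 10; 8; 4];
        Strand [::] [::] [:: 8] [:: 4; 2; 5] [:: 7; 6; 9] [:: 8; 11; 13; 9; 6; 10; 7]]);
    [vm_compute | lia | lia].
- by apply: (@tiles_family_mod _ 4 _ 11
    [:: Strand [::] [::] [:: 8; 6; 5] [:: 4; 1; 0; 3; 7] [:: 11] [:: 8; 10; 13; 9; 5; 6];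
        Strand [::] [::] [:: 9; 7; 8] [:: 5; 3; 4; 0; 2; 6] [:: 10] [:: 8; 9; 12; 10; 7];
        Strand [::] [::] [:: 9] [:: 5; 1; 2; 3; 6] [:: 4; 7; 10] [:: 7; 9; 10; 11; 8; 4];
        Strand [::] [::] [:: 8] [:: 4; 2; 5] [:: 7; 6; 9] [:: 8; 12; 14; 10; 6; 9; 11; 7]]);
    [vm_compute | lia | lia].
Qed.

Lemma tiles4_3_cycle m : 4 < m -> tiles pattern4 [::] [::] (rcons [:: 3] m).
Proof.
move=> hm.
have [->|n5] := eqVneq m 5.
  by apply: (@tiles_blockb _ _ _ _
    [:: [:: [:: 0; 1; 4]; [:: 3; 5; 7; 10; 6]];
      [:: [:: 0; 2; 3]; [:: 4; 5; 9; 6; 7]];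
      [:: [:: 1; 2; 5]; [:: 3; 4; 6; 8; 7]];
      [:: [:: 7; 9; 11]; [:: 2; 4; 8; 5; 6]]]); vm_compute.
have [->|n6] := eqVneq m 6.
  by apply: (@tiles_blockb _ _ _ _
    [:: [:: [:: 7; 8; 11]; [:: 0; 1; 4; 5; 6; 3]];
      [:: [:: 6; 7; 10]; [:: 0; 2; 3; 5; 8; 4]];
      [:: [:: 6; 8; 9]; [:: 1; 2; 4; 3; 7; 5]];
      [:: [:: 8; 10; 12]; [:: 2; 5; 9; 7; 4; 6]]]); vm_compute.
have [mc|[mc|[mc|mc]]] : m %% 4 = 0 \/ m %% 4 = 1 \/ m %% 4 = 2 \/ m %% 4 = 3 by lia.
- by apply: (@tiles_family_mod _ 4 _ 8
    [:: Strand [::] [:: [:: 9; 10; 13]] [:: 9; 8; 6] [:: 5; 4; 1; 0; 3; 7] [:: 11] [:: 6; 8];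
        Strand [::] [:: [:: 8; 9; 12]] [:: 9; 7; 8] [:: 5; 3; 4; 0; 2; 6] [:: 10] [:: 10; 7];
        Strand [::] [:: [:: 8; 10; 11]] [:: 9] [:: 5; 1; 2; 3; 6; 4; 7] [:: 10; 8; 11] [:: 9];
        Strand [::] [:: [:: 10; 12; 14]] [:: 9; 6; 7] [:: 5; 2; 4; 8] [:: 12] [:: 7; 11; 9; 6]]);
    [vm_compute | lia | lia].
- by apply: (@tiles_family_mod _ 4 _ 9
    [:: Strand [::] [:: [:: 10; 11; 14]] [:: 9; 6; 8] [:: 5; 4; 1; 0; 3; 7] [:: 11] [:: 6; 8; 9];
        Strand [::] [:: [:: 9; 10; 13]] [:: 9] [:: 5; 3; 6; 2; 0; 4; 7] [:: 10; 8; 11] [:: 11; 8];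
        Strand [::] [:: [:: 9; 11; 12]] [:: 9; 8; 7] [:: 5; 1; 2; 3; 4; 6] [:: 10] [:: 10; 8; 7];
        Strand [::] [:: [:: 11; 13; 15]] [:: 9; 7; 6] [:: 5; 2; 4; 8] [:: 12] [:: 12; 10; 7; 9; 6]]);
    [vm_compute | lia | lia].
- by apply: (@tiles_family_mod _ 4 _ 10
    [:: Strand [::] [:: [:: 11; 12; 15]] [:: 9; 6; 8] [:: 5; 4; 1; 0; 3; 7] [:: 11] [:: 8; 10; 6; 9];
        Strand [::] [:: [:: 10; 11; 14]] [:: 9] [:: 5; 3; 6; 2; 0; 4; 7] [:: 10; 8; 11] [:: 9; 12; 8];
        Strand [::] [:: [:: 10; 12; 13]] [:: 9; 8; 7] [:: 5; 1; 2; 3; 4; 6] [:: 10] [:: 8; 9; 11; 7];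
        Strand [::] [:: [:: 12; 14; 16]] [:: 9; 7; 6] [:: 5; 2; 4; 8] [:: 12] [:: 11; 13; 9; 10; 7; 6]]);
    [vm_compute | lia | lia].
- by apply: (@tiles_family_mod _ 4 _ 7
    [:: Strand [::] [:: [:: 8; 9; 12]] [:: 10; 8; 5] [:: 6; 4; 1; 0; 3; 7] [:: 11] [:: 5];
        Strand [::] [:: [:: 7; 8; 11]] [:: 9; 8; 7] [:: 5; 3; 4; 0; 2; 6] [:: 10] [:: 9];
        Strand [::] [:: [:: 7; 9; 10]] [:: 10; 7; 9] [:: 6; 3; 2; 1; 5; 4; 8] [:: 12] [::];
        Strand [::] [:: [:: 9; 11; 13]] [:: 9] [:: 5; 2; 4; 7] [:: 6; 8; 11] [:: 6; 10; 8]]);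
    [vm_compute | lia | lia].
Qed.

Lemma tiles4_33_cycle m : 4 < m -> tiles pattern4 [::] [::] (rcons [:: 3; 3] m).
Proof.
move=> hm.
have [->|n5] := eqVneq m 5.
  by apply: (@tiles_blockb _ _ _ _
    [:: [:: [:: 0; 1; 4]; [:: 3; 5; 6]; [:: 7; 8; 9; 13; 10]];
      [:: [:: 0; 2; 3]; [:: 4; 5; 7]; [:: 6; 9; 12; 8; 10]];
      [:: [:: 1; 2; 5]; [:: 9; 10; 11]; [:: 3; 4; 8; 6; 7]];
      [:: [:: 2; 4; 6]; [:: 10; 12; 14]; [:: 5; 8; 11; 7; 9]]]); vm_compute.
have [->|n6] := eqVneq m 6.
  by apply: (@tiles_blockb _ _ _ _
    [:: [:: [:: 5; 7; 9]; [:: 10; 11; 14]; [:: 0; 1; 4; 8; 6; 3]];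
      [:: [:: 7; 8; 11]; [:: 9; 10; 13]; [:: 0; 2; 3; 5; 6; 4]];
      [:: [:: 3; 4; 7]; [:: 9; 11; 12]; [:: 1; 2; 6; 10; 8; 5]];
      [:: [:: 2; 4; 5]; [:: 11; 13; 15]; [:: 6; 7; 10; 12; 8; 9]]]); vm_compute.
have [->|n7] := eqVneq m 7.
  by apply: (@tiles_blockb _ _ _ _
    [:: [:: [:: 7; 9; 10]; [:: 11; 12; 15]; [:: 0; 1; 4; 6; 8; 5; 3]];
      [:: [:: 8; 9; 12]; [:: 10; 11; 14]; [:: 0; 2; 3; 7; 6; 5; 4]];
      [:: [:: 7; 8; 11]; [:: 10; 12; 13]; [:: 1; 2; 4; 3; 6; 9; 5]];
      [:: [:: 9; 11; 13]; [:: 12; 14; 16]; [:: 2; 5; 7; 4; 8; 10; 6]]]); vm_compute.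
have [->|n8] := eqVneq m 8.
  by apply: (@tiles_blockb _ _ _ _
    [:: [:: [:: 5; 6; 9]; [:: 12; 13; 16]; [:: 0; 1; 4; 8; 10; 11; 7; 3]];
      [:: [:: 9; 10; 13]; [:: 11; 12; 15]; [:: 0; 2; 3; 5; 8; 7; 6; 4]];
      [:: [:: 8; 9; 12]; [:: 11; 13; 14]; [:: 1; 2; 4; 3; 6; 10; 7; 5]];
      [:: [:: 10; 12; 14]; [:: 13; 15; 17]; [:: 2; 5; 4; 7; 9; 11; 8; 6]]]); vm_compute.
have [->|n9] := eqVneq m 9.
  by apply: (@tiles_blockb _ _ _ _
    [:: [:: [:: 9; 11; 12]; [:: 13; 14; 17]; [:: 0; 1; 4; 8; 10; 6; 5; 7; 3]];
      [:: [:: 10; 11; 14]; [:: 12; 13; 16]; [:: 0; 2; 3; 5; 9; 7; 8; 6; 4]];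
      [:: [:: 9; 10; 13]; [:: 12; 14; 15]; [:: 1; 2; 4; 3; 6; 7; 11; 8; 5]];
      [:: [:: 11; 13; 15]; [:: 14; 16; 18]; [:: 2; 5; 4; 7; 10; 12; 8; 9; 6]]]); vm_compute.
have [mc|[mc|[mc|mc]]] : m %% 4 = 0 \/ m %% 4 = 1 \/ m %% 4 = 2 \/ m %% 4 = 3 by lia.
- by apply: (@tiles_family_mod _ 4 _ 12
    [:: Strand [:: [:: 0; 1; 4]; [:: 3; 5; 6]] [::] [:: 15; 12; 13] [:: 11; 7; 8; 9; 10; 14] [:: 18] [:: 15; 17; 20; 16; 12; 13];
        Strand [:: [:: 0; 2; 3]; [:: 4; 5; 8]] [::] [:: 15; 14; 12] [:: 11; 9; 6; 7; 10; 13] [:: 17] [:: 15; 16; 19; 17; 14; 12];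
        Strand [:: [:: 1; 2; 5]; [:: 3; 4; 7]] [::] [:: 15] [:: 11; 8; 6; 10; 12; 9; 13] [:: 16; 14; 17] [:: 14; 16; 17; 18; 15];
        Strand [:: [:: 2; 4; 6]; [:: 5; 7; 9]] [::] [:: 15; 13; 14] [:: 11; 10; 8; 12] [:: 16] [:: 15; 19; 21; 17; 13; 16; 18; 14]]);
    [vm_compute | lia | lia].
- by apply: (@tiles_family_mod _ 4 _ 13
    [:: Strand [:: [:: 0; 1; 4]; [:: 3; 5; 6]] [::] [:: 15; 12; 13] [:: 11; 7; 8; 9; 10; 14] [:: 18] [:: 15; 17; 21; 18; 16; 12; 13];
        Strand [:: [:: 0; 2; 3]; [:: 4; 5; 8]] [::] [:: 15; 14; 12] [:: 11; 9; 6; 7; 10; 13] [:: 17] [:: 15; 16; 17; 20; 18; 14; 12];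
        Strand [:: [:: 1; 2; 5]; [:: 3; 4; 7]] [::] [:: 15] [:: 11; 8; 6; 10; 12; 9; 13] [:: 16; 14; 17] [:: 14; 16; 19; 17; 18; 15];
        Strand [:: [:: 2; 4; 6]; [:: 5; 7; 9]] [::] [:: 15; 13; 14] [:: 11; 10; 8; 12] [:: 16] [:: 15; 19; 18; 22; 20; 16; 13; 17; 14]]);
    [vm_compute | lia | lia].
- by apply: (@tiles_family_mod _ 4 _ 10
    [:: Strand [:: [:: 0; 1; 4]; [:: 3; 5; 6]] [::] [:: 15; 12; 13] [:: 11; 7; 8; 9; 10; 14] [:: 18] [:: 18; 15; 12; 13];
        Strand [:: [:: 0; 2; 3]; [:: 4; 5; 8]] [::] [:: 15; 14; 12] [:: 11; 9; 6; 7; 10; 13] [:: 17] [:: 15; 17; 14; 12];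
        Strand [:: [:: 1; 2; 5]; [:: 3; 4; 7]] [::] [:: 15] [:: 11; 8; 6; 10; 12; 9; 13] [:: 16; 14; 17] [:: 14; 16; 15];
        Strand [:: [:: 2; 4; 6]; [:: 5; 7; 9]] [::] [:: 15; 13; 14] [:: 11; 10; 8; 12] [:: 16] [:: 16; 13; 17; 19; 15; 14]]);
    [vm_compute | lia | lia].
- by apply: (@tiles_family_mod _ 4 _ 11
    [:: Strand [:: [:: 0; 1; 4]; [:: 3; 5; 6]] [::] [:: 15; 12; 13] [:: 11; 7; 8; 9; 10; 14] [:: 18] [:: 15; 19; 16; 12; 13];
        Strand [:: [:: 0; 2; 3]; [:: 4; 5; 8]] [::] [:: 15; 14; 12] [:: 11; 9; 6; 7; 10; 13] [:: 17] [:: 15; 16; 18; 14; 12];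
        Strand [:: [:: 1; 2; 5]; [:: 3; 4; 7]] [::] [:: 15] [:: 11; 8; 6; 10; 12; 9; 13] [:: 16; 14; 17] [:: 14; 16; 17; 15];
        Strand [:: [:: 2; 4; 6]; [:: 5; 7; 9]] [::] [:: 15; 13; 14] [:: 11; 10; 8; 12] [:: 16] [:: 15; 18; 20; 16; 13; 17; 14]]);
    [vm_compute | lia | lia].
Qed.

(** Pairs the odd 4-cycle with a longer cycle when there is no triangle; a 5-cycle as partner is
    handled by [tiles4_trade_45]. *)
Lemma tiles4_4_cycle m : 5 < m -> tiles pattern4 [::] [::] (rcons [:: 4] m).
Proof.
move=> hm.
have [->|n6] := eqVneq m 6.
  by apply: (@tiles_blockb _ _ _ _
    [:: [:: [:: 0; 1; 4; 3]; [:: 5; 6; 7; 9; 12; 8]];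
      [:: [:: 6; 8; 11; 9]; [:: 0; 2; 3; 5; 7; 4]];
      [:: [:: 3; 6; 10; 7]; [:: 1; 2; 4; 8; 9; 5]];
      [:: [:: 2; 5; 4; 6]; [:: 7; 8; 10; 9; 13; 11]]]); vm_compute.
have [mc|[mc|[mc|mc]]] : m %% 4 = 0 \/ m %% 4 = 1 \/ m %% 4 = 2 \/ m %% 4 = 3 by lia.
- by apply: (@tiles_family_mod _ 4 _ 8
    [:: Strand [::] [:: [:: 7; 10; 14; 11]] [:: 10; 7; 5] [:: 6; 3; 0; 1; 4; 8] [:: 12] [:: 9; 5];
        Strand [::] [:: [:: 8; 10; 13; 11]] [:: 9] [:: 5; 3; 2; 0; 4; 6] [:: 7; 8; 10] [:: 9; 7];
        Strand [::] [:: [:: 9; 10; 11; 12]] [:: 9; 6; 8] [:: 5; 1; 2; 4; 3; 7] [:: 11] [:: 6; 8];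
        Strand [::] [:: [:: 9; 11; 15; 13]] [:: 10] [:: 6; 2; 5; 4; 7] [:: 9; 8; 11] [:: 8; 12; 10]]);
    [vm_compute | lia | lia].
- by apply: (@tiles_family_mod _ 4 _ 9
    [:: Strand [::] [:: [:: 9; 11; 15; 12]] [:: 10] [:: 6; 3; 0; 1; 4; 7] [:: 5; 8; 11] [:: 5; 8; 10];
        Strand [::] [:: [:: 8; 11; 14; 12]] [:: 9] [:: 5; 3; 2; 0; 4; 6] [:: 7; 8; 10] [:: 7; 10; 9];
        Strand [::] [:: [:: 10; 11; 12; 13]] [:: 9; 8; 6] [:: 5; 1; 2; 4; 3; 7] [:: 11] [:: 9; 8; 6];
        Strand [::] [:: [:: 10; 12; 16; 14]] [:: 10; 7; 9] [:: 6; 2; 5; 4; 8] [:: 12] [:: 7; 11; 13; 9]]);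
    [vm_compute | lia | lia].
- by apply: (@tiles_family_mod _ 4 _ 10
    [:: Strand [::] [:: [:: 9; 12; 16; 13]] [:: 10; 7; 5] [:: 6; 3; 0; 1; 4; 8] [:: 12] [:: 10; 11; 7; 5];
        Strand [::] [:: [:: 10; 12; 15; 13]] [:: 9] [:: 5; 3; 2; 0; 4; 6] [:: 7; 8; 10] [:: 7; 8; 11; 9];
        Strand [::] [:: [:: 11; 12; 13; 14]] [:: 9; 6; 8] [:: 5; 1; 2; 4; 3; 7] [:: 11] [:: 10; 6; 9; 8];
        Strand [::] [:: [:: 11; 13; 17; 15]] [:: 10] [:: 6; 2; 5; 4; 7] [:: 9; 8; 11] [:: 9; 10; 14; 12; 8]]);
    [vm_compute | lia | lia].
- by apply: (@tiles_family_mod _ 4 _ 7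
    [:: Strand [::] [:: [:: 7; 9; 13; 10]] [:: 9; 7; 8] [:: 5; 4; 1; 0; 3; 6] [:: 10] [:: 8];
        Strand [::] [:: [:: 6; 9; 12; 10]] [:: 9; 6; 7] [:: 5; 3; 2; 0; 4; 8] [:: 12] [:: 7];
        Strand [::] [:: [:: 8; 9; 10; 11]] [:: 9; 8; 6] [:: 5; 1; 2; 4; 3; 7] [:: 11] [:: 6];
        Strand [::] [:: [:: 8; 10; 14; 12]] [:: 9] [:: 5; 2; 6; 4; 7] [:: 10; 8; 11] [:: 11; 9]]);
    [vm_compute | lia | lia].
Qed.

(** * Coverings of complete multigraphs *)

(** Only injective placements of [F] and the multiplicity of each pair are recorded; parallel edges
    stay indistinct, which makes the notion additive in [lam]. *)
Definition covers (F : mgraph) (W : finType) (lam : nat) : Prop :=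
  exists (J : finType) (f : J -> vert F -> W),
    (forall j, injective (f j)) /\
    (forall a b, a != b -> \sum_j #|[set e | f j @: ends e == [set a; b]]| = lam).

Lemma covers_add F W l1 l2 : covers F W l1 -> covers F W l2 -> covers F W (l1 + l2).
Proof.
move=> [J1 [f1 [inj1 cov1]]] [J2 [f2 [inj2 cov2]]].
exists (J1 + J2)%type, (fun j => match j with inl j1 => f1 j1 | inr j2 => f2 j2 end).
split=> [[j|j]|a b ab]; [exact: inj1|exact: inj2|].
by rewrite big_sumType /= cov1 // cov2.
Qed.

Lemma covers_bij F (W W' : finType) (phi : W -> W') lam :
  bijective phi -> covers F W lam -> covers F W' lam.
Proof.
move=> [psi phiK psiK] [J [f [injf cov]]].
exists J, (fun j => phi \o f j); split=> [j|a b ab].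
  exact: inj_comp (can_inj phiK) (injf j).
rewrite -(cov (psi a) (psi b)) ?(inj_eq (can_inj psiK)) //.
apply: eq_bigr => j _; apply: eq_card => e; rewrite !inE imset_comp.
have -> : [set a; b] = phi @: [set psi a; psi b] by rewrite imsetU !imset_set1 !psiK.
by apply/eqP/eqP => [/(imset_inj (can_inj phiK))|->].
Qed.

(** The [lam] parallel edges over a pair are numbered and matched with the [lam] edges of copies of
    [F] that land on this pair; the copies then become colour classes. *)
Lemma factorisation_of_covers F n lam :
  #|vert F| = n -> covers F 'I_n lam -> has_factorisation (complete_mgraph lam n) F.
Proof.
move=> cardF [J [f [injf cov]]].
pose X (s : {e : {set 'I_n} | #|e| == 2}) :=
  [set je : J * edge F | f je.1 @: ends je.2 == val s].
have cardX s : lam = #|X s|.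
  have /cards2P[a [b [ab sE]]] := valP s.
  rewrite -(cov a b ab) -[RHS]sum1_card.
  rewrite (eq_bigr (fun j => \sum_(e in [set e | f j @: ends e == [set a; b]]) 1)).
    by rewrite pair_big_dep; apply: eq_bigl => je; rewrite !inE sE.
  by move=> j _; rewrite sum1_card.
(* [kappa] will be a bijection from the edges of the multigraph to the edges of all copies. *)
pose kappa (k : edge (complete_mgraph lam n)) : J * edge F :=
  enum_val (cast_ord (cardX k.1) k.2).
have kappaP k : f (kappa k).1 @: ends (kappa k).2 = val k.1.
  by have := enum_valP (cast_ord (cardX k.1) k.2); rewrite inE => /eqP.
have kappa_inj : injective kappa.
  move=> [s i] [s' i'] eqk.
  have ss' : s = s' by apply: val_inj; rewrite -(kappaP (s, i)) -(kappaP (s', i')) eqk.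
  by subst s'; move/enum_val_inj/cast_ord_inj: eqk => /= ->.
have card_im (j : J) (e : edge F) : #|f j @: ends e| == 2.
  by rewrite card_imset // card_ends.
have kappa_surj je : exists k, kappa k = je.
  pose s : {e : {set 'I_n} | #|e| == 2} := 
    exist (fun e : {set 'I_n} => #|e| == 2) (f je.1 @: ends je.2) (card_im je.1 je.2).
  have sX : je \in X s by rewrite inE.
  exists (s, cast_ord (esym (cardX s)) (enum_rank_in sX je)).
  by rewrite /kappa /= cast_ordKV enum_rankK_in.
pose colour (k : edge (complete_mgraph lam n)) : J := (kappa k).1.
exists (preim_partition colour [set: edge (complete_mgraph lam n)]).
split=> [|B /imsetP[k0 _ BE]]; first exact: preim_partitionP.
pose j := colour k0.
have inB k : (k \in B) = (colour k == j) by rewrite BE !inE eq_sym.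
have [fj' fjK fjK'] : bijective (f j) by apply: inj_card_bij (injf j) _; rewrite card_ord cardF.
(* The isomorphism inverts the placement of copy [j] on vertices and forgets the copy on edges. *)
exists fj', (fun e => (kappa (val e)).2); split.
- by exists (f j).
- apply: inj_card_bij => [e1 e2 eq12|].
    apply: val_inj; apply: kappa_inj.
    have := valP e1; have := valP e2; rewrite !inB /colour => /eqP c2 /eqP c1.
    by rewrite [LHS]surjective_pairing [RHS]surjective_pairing c1 c2 eq12.
  (* Every edge of [F] comes from an edge in [B], so [B] is at least as large as the edge set of
     [F]. *)
  rewrite card_sig; apply: (leq_trans _ (leq_imset_card (fun k => (kappa k).2) _)).
  apply: subset_leq_card; apply/subsetP => e _; apply/imsetP.
  have [k kE] := kappa_surj (j, e); exists k; last by rewrite kE.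
  by rewrite inB /colour kE.
- move=> e /=; rewrite -kappaP; have := valP e; rewrite inB /colour => /eqP ->.
  by rewrite -imset_comp (eq_imset _ fjK) imset_id.
Qed.

(** * Scaling by representatives of the units of [F_p] modulo sign *)

Section Scaling.

Import GRing.Theory.
Local Open Scope ring_scope.

Variable p : nat.
Hypotheses (p_pr : prime p) (p_odd : odd p).

Let half := p.-1./2.

Lemma natr_Fp_eq0 n : (n%:R == 0 :> 'F_p) = (p %| n)%N.
Proof. by rewrite (dvdn_pcharf (pchar_Fp p_pr)). Qed.

Lemma natr_Fp_inj m n : (m < p)%N -> (n < p)%N -> m%:R = n%:R :> 'F_p -> m = n.
Proof.
by move=> mp np /(congr1 (@nat_of_ord _)); rewrite !val_Fp_nat // !modn_small.
Qed.

Lemma sum_Fp (f : 'F_p -> nat) : (\sum_(u : 'F_p) f u = \sum_(0 <= i < p) f i%:R)%N.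
Proof.
suff sumN N : N = (Zp_trunc (pdiv p)).+2 ->
  (\sum_(u : 'F_p) f u = \sum_(0 <= i < N) f i%:R)%N by rewrite (sumN p) // Fp_cast.
by move=> ->; rewrite big_mkord; apply: eq_bigr => u _; rewrite natr_Zp.
Qed.

Lemma sum_units_Fp (f : 'F_p -> nat) :
  (\sum_(u : 'F_p | u != 0%R) f u
   = \sum_(1 <= i < half.+1) (f i%:R%R + f (- i%:R)%R))%N.
Proof.
have p_gt0 := prime_gt0 p_pr.
have pE : p = (half.+1 + half)%N by rewrite /half; have := odd_double_half p; rewrite p_odd; lia.
rewrite big_mkcond sum_Fp big_ltn // eqxx add0n.
rewrite big_nat (eq_bigr (fun i => f i%:R)); last first.
  move=> i /andP[i_gt0 ip]; rewrite natr_Fp_eq0.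
  by rewrite ifT //; apply/negP => /dvdn_leq; lia.
rewrite -big_nat (@big_cat_nat _ _ _ half.+1) //=; last by lia.
rewrite big_split /=; congr (_ + _)%N.
(* Read backwards, the residues above [half] are the negatives of 1, ..., [half]. *)
rewrite big_nat_rev /= [in RHS]big_nat [in LHS](_ : half.+1 = (1 + half)%N) //.
rewrite [in LHS](_ : index_iota (1 + half) p = index_iota (1 + half) (half + half.+1)) ?[in LHS]pE; last first.
  by congr index_iota; lia.
rewrite big_addn -[in RHS]big_nat.
have -> : (half + half.+1 - half = half.+1)%N by lia.
rewrite !big_nat; apply: eq_bigr => i /andP[i_gt0 ih]; congr f.
apply/eqP; rewrite -subr_eq0 opprK -natrD natr_Fp_eq0.
by rewrite (_ : _ + i = p)%N // ; lia.
Qed.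

Definition hits (a b : 'F_p) (e : 'F_p * 'F_p) : bool := [set e.1; e.2] == [set a; b].

Definition scale (u : 'F_p) (e : 'F_p * 'F_p) := (u * e.1, u * e.2).

Lemma hitsC a b x y : hits a b (x, y) = hits a b (y, x).
Proof. by rewrite /hits /= setUC. Qed.

Lemma set2_eq (T : finType) (x y a b : T) :
  a != b -> ([set x; y] == [set a; b]) = (x == a) && (y == b) || (x == b) && (y == a).
Proof.
move=> ab; apply/eqP/orP => [xyE|[]/andP[/eqP-> /eqP->] //]; last by rewrite setUC.
have : x \in [set a; b] by rewrite -xyE set21.
have : y \in [set a; b] by rewrite -xyE set22.
have : a \in [set x; y] by rewrite xyE set21.
have : b \in [set x; y] by rewrite xyE set22.
rewrite !inE => bxy axy /orP[]/eqP ya /orP[]/eqP xa; rewrite ya xa ?eqxx in bxy axy *.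
- by rewrite orbb eq_sym (negPf ab) in bxy.
- by right.
- by left.
- by rewrite orbb (negPf ab) in axy.
Qed.

Lemma sum_hits_translates a b w : a != b ->
  (\sum_(y : 'F_p) hits a b (y, y + w)%R = (w == b - a)%R + (w == a - b)%R)%N.
Proof.
move=> ab.
rewrite (eq_bigr (fun y : 'F_p =>
    ((y == a) && (w == b - a)%R) + ((y == b) && (w == a - b)%R))%N); last first.
  move=> y _; rewrite /hits set2_eq //=.
  have addE (c d : 'F_p) : (c + w == d) = (w == d - c).
    by rewrite [RHS]eq_sym subr_eq eq_sym addrC.
  rewrite !addE; have [->|ya] := eqVneq y a; first by rewrite (negPf ab) orbF addn0.
  by have [->|yb] := eqVneq y b.
have sum1 (c : 'F_p) (t : bool) : (\sum_(y : 'F_p) ((y == c) && t) = t)%N.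
  by rewrite (bigD1 c) //= eqxx big1 ?addn0 // => y /negPf ->.
by rewrite big_split /= !sum1.
Qed.

Lemma sum_hits_difference a b (w : 'F_p) : a != b -> w != 0 ->
  (\sum_(1 <= i < half.+1) \sum_(x : 'F_p) hits a b (scale i%:R (x, x + w))%R = 1)%N.
Proof.
move=> ab w0.
rewrite big_nat (eq_bigr (fun i => ((i%:R * w == b - a)%R + (- i%:R * w == b - a)%R)%N)).
  rewrite -big_nat -(sum_units_Fp (fun u => nat_of_bool (u * w == b - a))).
  (* The unit [(b - a) / w] is the only one that contributes. *)
  rewrite (bigD1 ((b - a) / w)) /=; last first.
    by rewrite mulf_neq0 ?invr_eq0 // subr_eq0 eq_sym.
  rewrite divfK // eqxx big1 ?addn0 // => u /andP[_ uw].
  by rewrite -(inj_eq (mulIf (invr_neq0 w0))) mulfK // (negPf uw).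
move=> i /andP[i_gt0 ih].
have i0 : i%:R != 0 :> 'F_p.
  by rewrite natr_Fp_eq0; apply/negP => /dvdn_leq; rewrite /half in ih; lia.
(* The equation [- i w = b - a] says [i w = a - b]: the two signs of the multiplier correspond to
   the two orientations of the pair. *)
rewrite mulNr eqr_oppLR opprB -sum_hits_translates //.
rewrite [RHS](reindex_inj (mulfI i0)) /=; apply: eq_bigr => x _.
by rewrite /scale /= mulrDr.
Qed.

Definition nb_hits a b e : nat := (\sum_(1 <= i < half.+1) hits a b (scale i%:R e)%R)%N.

Lemma nb_hitsC a b x y : nb_hits a b (x, y) = nb_hits a b (y, x).
Proof. by apply: eq_bigr => i _; rewrite /scale hitsC. Qed.

(** Together [e] and [- e] turn the sum over half of the units into a sum over all units, which
    multiplication by [s] permutes. *)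
Lemma nb_hits_scale a b s e : s != 0 ->
  (nb_hits a b e + nb_hits a b (- e.1, - e.2)%R
   = nb_hits a b (scale s e) + nb_hits a b (- (s * e.1), - (s * e.2))%R)%N.
Proof.
move=> s0; rewrite /nb_hits -!big_split /=.
have NE (x y : 'F_p) i : scale i (- x, - y) = scale (- i) (x, y).
  by rewrite /scale /= !mulrN !mulNr.
under eq_bigr do rewrite NE; under [RHS]eq_bigr do rewrite NE.
rewrite -(sum_units_Fp (fun u => nat_of_bool (hits a b (scale u (e.1, e.2))))).
rewrite -(sum_units_Fp (fun u => nat_of_bool (hits a b (scale u (s * e.1, s * e.2))))).
rewrite (reindex_inj (mulIf s0)); apply: eq_big => u; first by rewrite mulf_eq0 negb_or s0 andbT.
by move=> _; rewrite /scale /= !mulrA.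
Qed.

End Scaling.

(** * From segments to coverings *)

Definition cycle_system (F : mgraph) (cs : seq (seq (vert F))) : Prop :=
  [/\ uniq (flatten cs), forall v, v \in flatten cs
    & perm_eq [seq ends e | e <- enum (edge F)]
              [seq [set q.1; q.2] | q <- cycles_edges cs]].

Lemma card_edges_image (F : mgraph) (W : finType) (g : vert F -> W) cs A :
  cycle_system cs ->
  #|[set e | g @: ends e == A]|
  = count (fun q => [set q.1; q.2] == A) (cycles_edges (map (map g) cs)).
Proof.
case=> _ _ /permP/(_ (fun s => g @: s == A)); rewrite !count_map map_cycles_edges count_map.
move=> cE; transitivity (count (fun e => g @: ends e == A) (enum (edge F))).
  rewrite -size_filter cardE; apply/perm_size/uniq_perm; first exact: enum_uniq.
    exact/filter_uniq/enum_uniq.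
  by move=> e; rewrite mem_enum [RHS]mem_filter mem_enum inE andbT.
by rewrite enumT; apply: (etrans cE); apply: eq_count => q /=; rewrite imsetU !imset_set1.
Qed.

Lemma count_sum (T : Type) (a : pred T) s : count a s = \sum_(x <- s) a x.
Proof. by elim: s => [|x s IHs] /=; rewrite ?big_nil ?big_cons ?IHs. Qed.

Lemma cancel_middle (u t r c r' : nat) : u + (t + r) = c + (t + r') -> u + r = c + r'.
Proof. lia. Qed.

Section Covering.

Import GRing.Theory.
Local Open Scope ring_scope.

Variable p : nat.
Hypotheses (p_pr : prime p) (p_odd : odd p).

(* The origin is the centre 6 of the trade. *)
Definition pos (n : nat) : 'F_p := n%:R - 6%:R.

Definition pos2 (e : nat * nat) : 'F_p * 'F_p := (pos e.1, pos e.2).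

(** The two lists may differ as multisets of edges; they must only agree after summation over the
    multipliers. *)
Definition neutral (R R' : seq (nat * nat)) : Prop :=
  forall a b : 'F_p, a != b ->
    (\sum_(e <- R) nb_hits a b (pos2 e) = \sum_(e <- R') nb_hits a b (pos2 e))%N.

Lemma pos_add n : pos (p + n) = pos n.
Proof. by rewrite /pos natrD (eqP (_ : p%:R == 0)) ?add0r // natr_Fp_eq0. Qed.

Lemma uniq_pos_iota : uniq (map pos (iota 0 p)).
Proof.
rewrite map_inj_in_uniq ?iota_uniq // => m n; rewrite !mem_iota => mp np /addIr.
exact: natr_Fp_inj.
Qed.

Lemma sum_pos (f : 'F_p -> nat) : (\sum_(0 <= i < p) f (pos i) = \sum_(x : 'F_p) f x)%N.
Proof.
rewrite [RHS](reindex_inj (addIr (- 6%:R))) /=.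
by rewrite (sum_Fp p_pr (fun u => f (u - 6%:R))).
Qed.

Variables (F : mgraph) (cs : seq (seq (vert F))).
Hypothesis csP : cycle_system cs.
Variables (X : pattern) (R R' : seq (nat * nat)) (B : nat -> seq (seq nat)).
Hypotheses (blB : block X R R' (map size cs) B) (sz_cs : sumn (map size cs) = p).

(** The cycles of [F] and those of the [k]-th factor have the same lengths in the same order, so
    matching the flattened lists by index sends cycles to cycles. *)
Let g k v := pos (nth 0%N (flatten (B k)) (index v (flatten cs))).

Lemma size_factor k : (k < nfactors X)%N -> size (flatten (B k)) = size (flatten cs).
Proof. by case: blB => szB _ _ kd; rewrite !size_flatten /shape szB. Qed.

Lemma map_factor k : (k < nfactors X)%N -> map (map (g k)) cs = map (map pos) (B k).
Proof.
move=> kd; case: csP => ucs _ _; apply: eq_from_flatten_shape; last first.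
  rewrite /shape -!map_comp (eq_map (g := size)); last by move=> s /=; rewrite size_map.
  case: blB => szB _ _; rewrite -(szB k kd).
  by apply: eq_map => s /=; rewrite size_map.
rewrite -!map_flatten; apply: (@eq_from_nth _ 0); first by rewrite !size_map size_factor.
move=> i; rewrite size_map => i_lt.
case: (flatten cs) ucs i_lt (size_factor kd) @g => // v0 s ucs i_lt szE g0.
by rewrite (nth_map v0) // (nth_map 0%N) ?szE // /g0 index_uniq.
Qed.

(** Modulo [p] the vertices beyond the right end coincide with those left free at the left end; they
    cancel, and each residue is used once. *)
Lemma uniq_factor k : (k < nfactors X)%N -> uniq (map pos (flatten (B k))).
Proof.
move=> kd; case: blB => _ vB _; have := perm_map pos (vB k kd).
rewrite sz_cs !map_cat -[map pos (map _ _)]map_comp (eq_map pos_add) perm_cat2r.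
by move/perm_uniq->; exact: uniq_pos_iota.
Qed.

Lemma factor_inj k : (k < nfactors X)%N -> injective (g k).
Proof.
move=> kd v w; case: csP => _ incs _.
have gE u : g k u = nth 0 (map pos (flatten (B k))) (index u (flatten cs)).
  by rewrite (nth_map 0%N) // size_factor // index_mem.
rewrite !gE => /eqP; rewrite nth_uniq ?uniq_factor ?size_map ?size_factor ?index_mem //.
by move=> /eqP eq_i; rewrite -(nth_index v (incs v)) eq_i nth_index.
Qed.

Lemma count_factor a b u k : (k < nfactors X)%N ->
  #|[set e | (fun v => u * g k v) @: ends e == [set a; b]]|
  = count (fun e => hits a b (scale u (pos2 e))) (map upair (cycles_edges (B k))).
Proof.
move=> kd; rewrite (card_edges_image _ _ csP).
rewrite (_ : map _ cs = map (map ( *%R u)) (map (map (g k)) cs)); last first.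
  by rewrite -map_comp; apply: eq_map => s /=; rewrite -map_comp.
rewrite map_factor // !map_cycles_edges !count_map.
apply: eq_count => -[x y] /=; rewrite /upair /hits /scale /=.
by case: (leqP x y) => // _; rewrite setUC.
Qed.

Lemma sum_hits_circ a b (D : seq nat) : a != b -> all (fun w => ~~ (p %| w)%N) D ->
  (\sum_(1 <= i < p.-1./2.+1)
     count (fun e => hits a b (scale i%:R%R (pos2 e))) (circ_edges D 0 p) = size D)%N.
Proof.
move=> ab Dp.
rewrite (eq_bigr (fun i => \sum_(w <- D) \sum_(x : 'F_p)
    hits a b (scale i%:R%R (x, x + w%:R)%R))%N); last first.
  move=> i _; rewrite [RHS]exchange_big; apply: etrans (sum_pos _).
  rewrite count_sum /circ_edges big_flatten big_map /index_iota subn0.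
  apply: eq_bigr => x _; rewrite big_map; apply: eq_bigr => w _.
  by rewrite /pos2 /= {2}/pos natrD addrAC.
rewrite exchange_big /= -sum1_size !big_seq; apply: eq_bigr => w wD.
by apply: sum_hits_difference => //; rewrite natr_Fp_eq0 //; apply: (allP Dp).
Qed.

Lemma covers_block :
  all (fun w => ~~ (p %| w)%N) (pdiffs X) -> neutral R R' ->
  covers F 'F_p (size (pdiffs X)).
Proof.
move=> Dp RR'.
(* A copy is a factor together with a multiplier; the index [i] stands for the multiplier [i.+1]. *)
exists ('I_(nfactors X) * 'I_(p.-1./2))%type, 
  (fun (j : 'I_(nfactors X) * 'I_(p.-1./2)) v => j.2.+1%:R * g j.1 v).
split=> [[k i]|a b ab] /=.
  apply: inj_comp (factor_inj (ltn_ord k)); apply: mulfI.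
  by rewrite natr_Fp_eq0 //; apply/negP => /dvdn_leq; have := ltn_ord i; lia.
pose Q (i : nat) e := hits a b (scale i%:R (pos2 e)).
rewrite -(pair_bigA _ (fun (k : 'I__) (i : 'I__) =>
   #|[set e | (fun v => i.+1%:R * g k v) @: ends e == [set a; b]]|)) /=.
rewrite exchange_big /=.
rewrite (eq_bigr (fun i : 'I__ => count (Q i.+1)
    (all_edges (nfactors X) (fun k => cycles_edges (B k))))); last first.
  by move=> i _; rewrite count_all_edges; apply: eq_bigr => k _; rewrite count_factor.
rewrite -(big_mkord xpredT (fun i => count (Q i.+1)
    (all_edges (nfactors X) (fun k => cycles_edges (B k))))).
rewrite -(big_add1 _ _ 0%N p.-1./2.+1 xpredT (fun i => count (Q i)
    (all_edges (nfactors X) (fun k => cycles_edges (B k))))).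
have sumQ (E : seq (nat * nat)) :
    (\sum_(1 <= i < p.-1./2.+1) count (Q i) E = \sum_(e <- E) nb_hits a b (pos2 e))%N.
  by rewrite [RHS]exchange_big; apply: eq_bigr => i _; rewrite count_sum.
case: blB => _ _ eB.
(* For a single multiplier the edges of the pattern cancel modulo [p], but [R] and [R'] remain;
   neutrality removes them only from the sum [sumE]. *)
have eBi i : (count (Q i) (all_edges (nfactors X) (fun k => cycles_edges (B k)))
     + count (Q i) R = count (Q i) (circ_edges (pdiffs X) 0 p) + count (Q i) R')%N.
  have /permP/(_ (Q i)) := eB; rewrite sz_cs !count_cat count_map.
  rewrite [count (preim _ _) _](eq_count (a2 := Q i)); first exact: cancel_middle.
  by move=> e; rewrite /Q /= /pos2 /= !pos_add.
have sumE : (\sum_(1 <= i < p.-1./2.+1)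
      (count (Q i) (all_edges (nfactors X) (fun k => cycles_edges (B k))) + count (Q i) R)
    = \sum_(1 <= i < p.-1./2.+1)
      (count (Q i) (circ_edges (pdiffs X) 0 p) + count (Q i) R'))%N.
  by apply: eq_bigr => i _; exact: eBi.
move: sumE; rewrite !big_split /= (sum_hits_circ ab Dp) (sumQ R) (sumQ R') (RR' a b ab).
exact: addIn.
Qed.

End Covering.

Lemma trade_count (s t u v x y : nat) :
  u + v = s + t -> x + x = y + y -> x + (s + t) = y + (u + v).
Proof. lia. Qed.

(** * Neutrality of the trade *)

Section Trade.

Import GRing.Theory.
Local Open Scope ring_scope.

Lemma neutral_nil p : neutral p [::] [::].
Proof. by []. Qed.

Lemma pos_natD p m : pos p (6 + m) = m%:R.
Proof. by rewrite /pos natrD addrC addKr. Qed.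

Lemma pos_natB p n m : (n + m = 6)%N -> pos p n = - m%:R.
Proof. by rewrite /pos => <-; rewrite natrD opprD addNKr. Qed.

Lemma neutral_trade p : prime p -> odd p -> neutral p trade_out trade_in.
Proof.
move=> p_pr p_odd a b ab; rewrite /trade_out /trade_in !big_cons !big_nil !addn0 /pos2 /=.
rewrite (@pos_natB p 5 1) // (@pos_natB p 4 2) // (@pos_natB p 2 4) //.
rewrite (@pos_natD p 1) (@pos_natD p 2) (@pos_natD p 4).
have u2 : 2%:R != 0 :> 'F_p.
  by rewrite natr_Fp_eq0 //; case: p p_pr p_odd {a b ab} => [|[|[|[|n]]]].
have u4 : 4%:R != 0 :> 'F_p by rewrite -[4%N]/(2 * 2)%N natrM mulf_neq0.
(* The multiplier 4 sends {-1, 1} to {-4, 4}; each is its own negative, so both counts appear twice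
   and [trade_count] halves them. The multiplier 2 sends {1, 2} and {-2, -1} to {2, 4} and {-4,
   -2}. *)
have := @nb_hits_scale p p_pr p_odd a b _ (- 1%:R, 1%:R) u4.
have := @nb_hits_scale p p_pr p_odd a b _ (1%:R, 2%:R) u2.
rewrite /scale /= !(mulrN, mulr1, opprK) -natrM -[(2 * 2)%N]/4%N.
rewrite (nb_hitsC a b 1 (-1)) (nb_hitsC a b 4%:R (- 4%:R)).
rewrite (nb_hitsC a b (- 4%:R) (- 2%:R)) (nb_hitsC a b (- 2%:R) (- 1)).
exact: trade_count.
Qed.

End Trade.

(** * Cycles of a 2-regular graph *)

Lemma map_next (T : eqType) (c : seq T) : uniq c -> map (next c) c = rot 1 c.
Proof.
case: c => [|y s] // us; rewrite rot1_cons.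
apply: (@eq_from_nth _ y); first by rewrite size_map size_rcons.
move=> i; rewrite size_map => i_lt.
rewrite (nth_map y) // next_nth mem_nth // index_uniq // nth_rcons.
by case: leqP => // le_i; rewrite nth_default // if_same.
Qed.

Lemma cycle_edges_next (T : eqType) (c : seq T) :
  uniq c -> cycle_edges c = [seq (x, next c x) | x <- c].
Proof.
move=> uc; rewrite /cycle_edges -map_next //.
by elim: {1 3 5}c => //= x s ->.
Qed.

Lemma next_neq_prev (T : eqType) (c : seq T) x :
  uniq c -> 2 < size c -> x \in c -> next c x != prev c x.
Proof.
move=> uc sc xc; have [i s cE] := rot_to xc.
have us : uniq (x :: s) by rewrite -cE rot_uniq.
rewrite -(next_rot i uc) -(prev_rot i uc) cE.
case: s cE us => [|y [|z s]] cE us; try by rewrite -(size_rot i) cE in sc.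
apply/negP => /eqP/(congr1 (next (x :: y :: z :: s))).
rewrite next_prev //= eqxx; move: us; rewrite /= !inE !negb_or => /andP[/and3P[xy xz _] _].
by rewrite eq_sym (negPf xy) eqxx => zx; rewrite zx eqxx in xz.
Qed.

Lemma uniq_cycle_pairs (T : finType) (c : seq T) :
  uniq c -> 2 < size c -> uniq [seq [set x; next c x] | x <- c].
Proof.
move=> uc sc; rewrite map_inj_in_uniq // => x y xc yc xyE.
have : x \in [set y; next c y] by rewrite -xyE set21.
rewrite !inE => /orP[/eqP //|/eqP xE].
have : y \in [set x; next c x] by rewrite xyE set21.
rewrite !inE => /orP[/eqP //|/eqP yE].
by have := next_neq_prev uc sc xc; rewrite {2}xE prev_next // -yE eqxx.
Qed.

Lemma flatten_uniq_eq (T : eqType) (ss : seq (seq T)) s t x :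
  uniq (flatten ss) -> s \in ss -> t \in ss -> x \in s -> x \in t -> s = t.
Proof.
elim: ss => //= r ss IHss; rewrite cat_uniq => /and3P[_ /hasPn rss uss].
have notin u : u \in ss -> x \in u -> x \notin r.
  by move=> uss' xu; apply: rss; apply/flattenP; exists u.
rewrite !inE => /orP[/eqP->|sss] /orP[/eqP->|tss] // xs xt.
- by have := notin t tss xt; rewrite xs.
- by have := notin s sss xs; rewrite xt.
- exact: IHss.
Qed.

Lemma flatten_uniq_uniq (T : eqType) (ss : seq (seq T)) :
  uniq (flatten ss) -> all (fun s => 0 < size s) ss -> uniq ss.
Proof.
elim: ss => //= r ss IHss; rewrite cat_uniq => /and3P[_ /hasPn rss uss] /andP[r0 ss0].
rewrite IHss // andbT; apply/negP => rin; case: r r0 rss rin => // x r _ rss rin.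
have := rss x; rewrite mem_head => /(_ _)/negP; apply=> //.
by apply/flattenP; exists (x :: r); rewrite ?mem_head.
Qed.

Section TwoRegular.

Variable F : mgraph.
Hypotheses (simF : simple_graph F) (regF : regular_graph 2 F).

Definition nbrs (x : vert F) : {set vert F} := [set y | [exists e, ends e == [set x; y]]].

Lemma nbrsP x y : reflect (exists e, ends e = [set x; y]) (y \in nbrs x).
Proof. by rewrite inE; apply: (iffP existsP) => -[e eE]; exists e; apply/eqP. Qed.

Lemma nbrs_sym x y : (y \in nbrs x) = (x \in nbrs y).
Proof. by apply/nbrsP/nbrsP => -[e eE]; exists e; rewrite eE setUC. Qed.

Lemma nbrs_irr x : x \notin nbrs x.
Proof. by apply/nbrsP => -[e eE]; have := card_ends e; rewrite eE setUid cards1. Qed.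

Lemma ends_nbr e x : x \in ends e -> exists2 y, y \in nbrs x & ends e = [set x; y].
Proof.
move=> xe; have /cards2P[a [b [ab eE]]] := card_ends e.
by move: xe; rewrite eE !inE => /orP[]/eqP xE; subst x;
  [exists b | exists a; rewrite 1?setUC //]; rewrite //; apply/nbrsP; exists e; rewrite // setUC.
Qed.

(** By simplicity an edge at [x] is determined by its other end. *)
Lemma card_nbrs x : #|nbrs x| = 2.
Proof.
rewrite -(regF x) /vdegree -(card_imset _ simF).
rewrite -(@card_in_imset _ _ (fun y => [set x; y])); last first.
  move=> y z yN zN yzE; have : y \in [set x; z] by rewrite -yzE set22.
  rewrite !inE => /orP[/eqP yx|/eqP //].
  by rewrite yx (negPf (nbrs_irr x)) in yN.
congr #|pred_of_set _|; apply/setP => s; apply/imsetP/imsetP => -[].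
  by move=> y /nbrsP[e eE] ->; exists e => //; rewrite inE eE set21.
by move=> e; rewrite inE => /ends_nbr[y yN eE] ->; exists y.
Qed.

Definition nbr : rel (vert F) := fun x y => y \in nbrs x.

Lemma nbrs_cycle c x : uniq c -> 2 < size c -> cycle nbr c -> x \in c ->
  nbrs x = [set next c x; prev c x].
Proof.
move=> uc sc cc xc; apply/esym/eqP; rewrite eqEcard card_nbrs cards2 next_neq_prev //= andbT.
apply/subsetP => y; rewrite in_set2 => /orP[]/eqP->; first exact: (next_cycle cc xc).
by rewrite nbrs_sym; exact: (prev_cycle cc xc).
Qed.

Lemma mem_cycle_closed (A : {pred vert F}) c x :
  (forall y, y \in A -> {subset nbrs y <= A}) ->
  cycle nbr c -> x \in c -> x \in A -> {subset c <= A}.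
Proof.
move=> clA cc xc xA y; have [i s cE] := rot_to xc.
rewrite -(mem_rot i) cE; move: cc; rewrite -(rot_cycle i) cE /= rcons_path => /andP[ps _].
elim: s x xA ps {xc cE} => [|z s IHs] x xA /=; first by rewrite inE => _ /eqP->.
case/andP=> xz ps; rewrite inE => /orP[/eqP->//|].
exact: IHs (clA x xA z xz) ps.
Qed.

(** Strictly inside [t], the vertex [z] would have three neighbours: [x] and the two vertices next
    to it on the path. *)
Lemma path_head_nbr x t z : uniq (x :: t) -> path nbr x t -> z \in nbrs x -> z \in t ->
  z = head x t \/ z = last x t.
Proof.
move=> + + zN zt; case/splitPr: zt => t1 t2.
case/lastP: t1 => [|t1 a]; first by left.
case: t2 => [|b t2]; first by right; rewrite last_cat.
rewrite cons_uniq => /andP[xt]; rewrite cat_uniq => /and3P[_ /hasPn disj _].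
have xa : x != a by apply: contraNneq xt => ->; rewrite mem_cat mem_rcons mem_head.
have xb : x != b by apply: contraNneq xt => ->; rewrite mem_cat !inE eqxx !orbT.
have anb : a != b.
  have := disj b; rewrite !inE eqxx orbT => /(_ isT).
  by apply: contraNneq => <-; rewrite mem_rcons mem_head.
rewrite cat_path last_rcons /= => /and4P[_ az zb _].
have : [set a; b; x] \subset nbrs z.
  apply/subsetP => y; rewrite in_setU in_set2 in_set1 => /orP[/orP[]|]/eqP->.
  - by rewrite nbrs_sym.
  - by [].
  - by rewrite nbrs_sym.
move/subset_leq_card; rewrite card_nbrs -setUA cardsU1 cards2 !inE negb_or anb.
by rewrite [a == x]eq_sym xa [b == x]eq_sym xb.
Qed.

(** A longest path in [W] cannot be extended at its start [x], so both neighbours of [x] lie on it.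
    By [path_head_nbr] they are the next vertex and the last one; these are distinct, so the path
    closes to a cycle of length at least 3. *)
Lemma cycle_in (W : {set vert F}) x0 :
  x0 \in W -> (forall x, x \in W -> nbrs x \subset W) ->
  exists c, [/\ uniq c, 2 < size c, cycle nbr c & {subset c <= W}].
Proof.
move=> x0W clW.
pose P n := [exists t : n.-tuple (vert F),
  [&& 0 < n, uniq t, sorted nbr t & all (fun y => y \in W) t]].
have exP : exists n, P n.
  by exists 1; apply/existsP; exists [tuple x0]; rewrite /= x0W.
have ubP n : P n -> n <= #|vert F|.
  case/existsP => t /and4P[_ ut _ _].
  by rewrite -(size_tuple t) -(card_uniqP ut) max_card.
case: (ex_maxnP exP ubP) => n /existsP[[s szt]] /and4P[n0 us pt Wt] maxn.
case: s szt us pt Wt => [|x t] szt us pt Wt; first by rewrite -(eqP szt) in n0.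
rewrite /= in pt Wt.
have Nt : {subset nbrs x <= t}.
  move=> y yN; case/andP: Wt => xW Wt.
  have yx : y != x by apply: contraTneq yN => ->; exact: nbrs_irr.
  apply/negPn/negP => yt.
  suff: P n.+1 by move/maxn; rewrite ltnn.
  have szy : size [:: y, x & t] == n.+1 by rewrite -(eqP szt).
  apply/existsP; exists (Tuple szy); rewrite /= inE negb_or yx yt.
  rewrite /nbr nbrs_sym yN xW Wt pt (subsetP (clW x xW)) //= andbT.
  by move: us; rewrite cons_uniq.
have /cards2P[y [z [yz NE]]] : #|nbrs x| == 2 by rewrite card_nbrs.
have yN : y \in nbrs x by rewrite NE set21.
have zN : z \in nbrs x by rewrite NE set22.
have lastN : last x t \in nbrs x /\ head x t != last x t.
  have [yE|yE] := path_head_nbr us pt yN (Nt y yN);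
  have [zE|zE] := path_head_nbr us pt zN (Nt z zN).
  - by rewrite yE zE eqxx in yz.
  - by rewrite -yE -zE.
  - by rewrite -yE -zE eq_sym.
  - by rewrite yE zE eqxx in yz.
exists (x :: t); split=> //.
- by case: t lastN {szt us pt Wt Nt yN zN NE} => [|a [|b t]] //= []; rewrite eqxx.
- by rewrite /= rcons_path pt; case: lastN => lN _; rewrite /nbr nbrs_sym.
- by move=> v; have /allP WP : all (fun y => y \in W) (x :: t) := Wt; exact: WP.
Qed.

(** The vertices of a cycle have both neighbours on it, so removing the cycle leaves a closed set;
    induction on the size. *)
Lemma cycles_of_closed (W : {set vert F}) : (forall x, x \in W -> nbrs x \subset W) ->
  exists cs, [/\ uniq (flatten cs), flatten cs =i W
    & forall c, c \in cs -> [/\ uniq c, 2 < size c & cycle nbr c]].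
Proof.
have [n] := ubnP #|W|; elim: n W => // n IHn W Wn clW.
have [->|[x0 x0W]] := set_0Vmem W.
  by exists [::]; split=> // x; rewrite inE.
have [c [uc sc cc cW]] := cycle_in x0W clW.
pose W' := W :\: [set x in c].
have clW' x : x \in W' -> nbrs x \subset W'.
  rewrite !inE => /andP[xc xW]; apply/subsetP => y yN; rewrite !inE.
  rewrite (subsetP (clW x xW)) // andbT; apply/negP => yc.
  move: yN; rewrite nbrs_sym (nbrs_cycle uc sc cc yc) !inE => /orP[]/eqP xE.
    by rewrite xE mem_next yc in xc.
  by rewrite xE mem_prev yc in xc.
have ltW : #|W'| < n.
  rewrite -ltnS; apply: leq_trans Wn; rewrite ltnS; apply: proper_card.
  apply/properP; split; first exact: subsetDl.
  case: c uc sc cc cW @W' clW' => // a c _ _ _ cW W' _.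
  by exists a; [apply: cW; rewrite mem_head | rewrite !inE eqxx].
have [cs [ucs csW csP]] := IHn W' ltW clW'.
exists (c :: cs); split=> /=.
- rewrite cat_uniq uc ucs andbT; apply/hasPn => x; rewrite csW !inE.
  by case/andP.
- move=> x; rewrite mem_cat csW !inE; have [/cW ->|] := boolP (x \in c) => //.
- by move=> d; rewrite inE => /orP[/eqP->|/csP].
Qed.

Lemma handshake : #|edge F| = #|vert F|.
Proof.
have sumE : \sum_(v : vert F) vdegree v = \sum_(e : edge F) #|ends e|.
  rewrite (eq_bigr (fun v => \sum_(e | v \in ends e) 1)); last first.
    by move=> v _; rewrite sum1dep_card.
  by rewrite (exchange_big_dep xpredT) //=; apply: eq_bigr => e _; rewrite sum1_card.
move: sumE; rewrite (eq_bigr (fun=> 2)) // [in RHS](eq_bigr (fun=> 2)); last first.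
  by move=> e _; apply/eqP/card_ends.
by rewrite !sum_nat_const => /eqP; rewrite eqn_pmul2r // => /eqP; exact: esym.
Qed.

Lemma ends_in_cycle c e x : uniq c -> 2 < size c -> cycle nbr c -> x \in c -> x \in ends e ->
  ends e \in [seq [set y; next c y] | y <- c].
Proof.
move=> uc sc cc xc /ends_nbr[y]; rewrite (nbrs_cycle uc sc cc xc) in_set2.
case/orP=> /eqP-> ->; apply/mapP; first by exists x.
by exists (prev c x); rewrite ?mem_prev // next_prev // setUC.
Qed.

Lemma size_cycles_edges (T : Type) (ss : seq (seq T)) :
  size (cycles_edges ss) = size (flatten ss).
Proof.
elim: ss => //= s ss IHss; rewrite [size _]size_cat size_cat -IHss.
by rewrite size_zip size_rot minnn.
Qed.

(** Every edge is among the consecutive pairs of the cycles, and there are only as many pairs as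
    vertices, that is, as edges; so the inclusion is a permutation. *)
Lemma cycle_system_of cs : uniq (flatten cs) -> (forall v, v \in flatten cs) ->
  (forall c, c \in cs -> [/\ uniq c, 2 < size c & cycle nbr c]) -> cycle_system cs.
Proof.
move=> ucs allcs csP; split=> //.
set s1 := map _ _; set s2 := map _ _.
have us1 : uniq s1 by rewrite map_inj_uniq ?enum_uniq.
have sub12 : {subset s1 <= s2}.
  move=> z /mapP[e _ ->]; have /card_gt0P[x xe] : 0 < #|ends e| by rewrite (eqP (card_ends e)).
  have /flattenP[c ccs xc] := allcs x; have [uc sc cc] := csP c ccs.
  have /mapP[y yc ->] := ends_in_cycle uc sc cc xc xe.
  apply/mapP; exists (y, next c y) => //; apply/flattenP; exists (cycle_edges c); first exact: map_f.
  by rewrite cycle_edges_next //; apply/mapP; exists y.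
have sz21 : size s2 <= size s1.
  have -> : size s1 = #|vert F| by rewrite size_map -cardE handshake.
  rewrite size_map size_cycles_edges cardE.
  by apply: uniq_leq_size => // v _; rewrite mem_enum.
apply: uniq_perm => //; first exact: leq_size_uniq us1 sub12 sz21.
by case: (uniq_min_size us1 sub12 sz21).
Qed.

(** For a cycle [c] this is its edge set, by 2-regularity; it depends neither on the starting vertex
    nor on the direction, in accordance with [nu], which counts edge sets. *)
Definition edges_within (c : seq (vert F)) : {set edge F} := [set e | ends e \subset c].

Lemma is_cycle_edges_within c : uniq c -> 2 < size c -> cycle nbr c ->
  is_cycle (size c) (edges_within c).
Proof.
move=> uc sc cc; rewrite /is_cycle (ltnW sc) /=; apply/existsP; exists (in_tuple c).
rewrite /= uc; apply: uniq_perm; first by rewrite map_inj_uniq ?enum_uniq.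
  exact: uniq_cycle_pairs.
move=> z; apply/mapP/mapP => [[e]|[x xc ->]].
  rewrite mem_enum inE => /subsetP ec ->.
  have /card_gt0P[x xe] : 0 < #|ends e| by rewrite (eqP (card_ends e)).
  by have /mapP[y] := ends_in_cycle uc sc cc (ec x xe) xe; exists y.
have /nbrsP[e eE] := next_cycle cc xc.
exists e; rewrite // mem_enum inE eE; apply/subsetP => y.
by rewrite in_set2 => /orP[]/eqP->; rewrite ?mem_next.
Qed.

Lemma is_cycleE m C : 2 < m -> is_cycle m C ->
  exists c, [/\ uniq c, size c = m, cycle nbr c & C = edges_within c].
Proof.
move=> m2 /andP[_ /existsP[c /andP[uc /perm_mem cE]]].
have sc : 2 < size c by rewrite size_tuple.
have cc : cycle nbr c.
  apply: cycle_from_next => // x xc; apply/nbrsP.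
  have : [set x; next c x] \in [seq [set y; next c y] | y <- c] by apply: map_f.
  by rewrite -cE => /mapP[e _ eE]; exists e.
exists c; split; rewrite ?size_tuple //.
apply/setP => e; rewrite inE; apply/idP/idP => [eC|/subsetP ec].
  have : ends e \in [seq [set y; next c y] | y <- c].
    by rewrite -cE; apply: map_f; rewrite mem_enum.
  case/mapP=> x xc ->; apply/subsetP => y.
  by rewrite in_set2 => /orP[]/eqP->; rewrite ?mem_next.
have /card_gt0P[x xe] : 0 < #|ends e| by rewrite (eqP (card_ends e)).
have := ends_in_cycle uc sc cc (ec x xe) xe; rewrite -cE => /mapP[e' e'C /simF ->].
by rewrite mem_enum in e'C.
Qed.

Lemma cycle_closed c : uniq c -> 2 < size c -> cycle nbr c ->
  forall y, y \in c -> {subset nbrs y <= c}.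
Proof.
move=> uc sc cc y yc z; rewrite (nbrs_cycle uc sc cc yc) in_set2.
by case/orP=> /eqP->; rewrite ?mem_next ?mem_prev.
Qed.

Lemma nu_count cs m : uniq (flatten cs) -> (forall v, v \in flatten cs) ->
  (forall c, c \in cs -> [/\ uniq c, 2 < size c & cycle nbr c]) -> 2 < m ->
  nu m F = count (fun c => size c == m) cs.
Proof.
move=> ucs allcs csP m2; pose cm := [seq c <- cs | size c == m].
have uE : uniq (map edges_within cm).
  rewrite map_inj_in_uniq ?filter_uniq //.
    apply: flatten_uniq_uniq => //; apply/allP => c /csP[_ sc _]; exact: ltn_trans sc.
  move=> c d; rewrite !mem_filter => /andP[_ ccs] /andP[_ dcs] cdE.
  have [uc sc cc] := csP c ccs; have [x xc] : exists x, x \in c.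
    by case: c sc {uc cc cdE ccs} => // x c _; exists x; rewrite mem_head.
  have /nbrsP[e eE] := next_cycle cc xc.
  have : e \in edges_within d.
    rewrite -cdE inE eE; apply/subsetP => y.
    by rewrite in_set2 => /orP[]/eqP->; rewrite ?mem_next.
  rewrite inE eE => /subsetP/(_ x); rewrite set21 => /(_ isT) xd.
  exact: flatten_uniq_eq ucs ccs dcs xc xd.
rewrite -size_filter -(size_map edges_within) -(card_uniqP uE); apply: eq_card => C.
rewrite inE; apply/idP/mapP => [|[c]]; last first.
  rewrite mem_filter => /andP[/eqP <- /csP[uc sc cc]] ->.
  exact: is_cycle_edges_within.
move/(is_cycleE m2) => [c [uc szc cc ->]].
have sc : 2 < size c by rewrite szc.
have [x xc] : exists x, x \in c by case: (c) sc => // x ? _; exists x; rewrite mem_head.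
have /flattenP[d dcs xd] := allcs x; have [ud sd cd] := csP d dcs.
(* Two cycles that meet have the same vertices, both being closed under neighbours. *)
have cdE : c =i d.
  move=> y; apply/idP/idP; first exact: mem_cycle_closed (cycle_closed ud sd cd) cc xc xd y.
  exact: mem_cycle_closed (cycle_closed uc sc cc) cd xd xc y.
exists d.
  by rewrite mem_filter dcs -szc (perm_size (uniq_perm uc ud cdE)) eqxx.
by apply/setP => e; rewrite !inE; apply: eq_subset_r.
Qed.

Lemma ex_cycle_system : exists cs : seq (seq (vert F)),
  [/\ cycle_system cs, all (fun c => 2 < size c) cs
    & forall m, 2 < m -> nu m F = count (fun c => size c == m) cs].
Proof.
have [|cs [ucs allcs csP]] := @cycles_of_closed [set: vert F].
  by move=> x _; apply: subsetT.
have incs v : v \in flatten cs by rewrite allcs inE.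
exists cs; split; first exact: cycle_system_of.
  by apply/allP => c /csP[].
by move=> m m2; apply: nu_count.
Qed.

End TwoRegular.

(** * Assembling the segments *)

Lemma tiles_flatten X (mss : seq (seq nat)) :
  (forall ms, ms \in mss -> tiles X [::] [::] ms) -> tiles X [::] [::] (flatten mss).
Proof.
elim: mss => [|ms mss IHmss] tms /=; first exact: tiles_nil.
apply: tiles_cat; first by apply: tms; rewrite mem_head.
by apply: IHmss => ms' ms'in; apply: tms; rewrite inE ms'in orbT.
Qed.

Lemma tiles_singletons X s :
  (forall m, m \in s -> tiles X [::] [::] [:: m]) -> tiles X [::] [::] s.
Proof.
move=> ts; rewrite -[s](@map_id) -flatten_map1; apply: tiles_flatten => ms /mapP[m ms' ->].
exact: ts.
Qed.

Lemma nseq_flatten (T : Type) (n k : nat) (x : T) :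
  nseq (k * n) x = flatten (nseq n (nseq k x)).
Proof.
by elim: n => [|n IHn]; rewrite ?muln0 // mulnS /= -IHn nseqD.
Qed.

Lemma tiles_nseq X k n m : tiles X [::] [::] (nseq k m) -> tiles X [::] [::] (nseq (k * n) m).
Proof.
by move=> tk; rewrite nseq_flatten; apply: tiles_flatten => ms /nseqP[-> _].
Qed.

Lemma perm_lengths s : all (fun m => 2 < m) s ->
  perm_eq s (nseq (count_mem 3 s) 3 ++ nseq (count_mem 4 s) 4 ++ [seq m <- s | 4 < m]).
Proof.
elim: s => //= m s IHs /andP[m2 /IHs {}IHs].
have [->|m3] := eqVneq m 3; first by rewrite /= perm_cons.
have [->|m4] := eqVneq m 4.
  rewrite add0n /= perm_sym -cat1s perm_catCA /= perm_cons perm_sym.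
  by [].
rewrite ifT; last by lia.
rewrite !add0n perm_sym catA perm_catC /= perm_cons perm_catC -catA perm_sym.
by [].
Qed.

Lemma ex_tiles3 s : all (fun m => 2 < m) s ->
  count_mem 3 s <= count_mem 5 s + count (fun m => 6 < m) s ->
  exists2 s', perm_eq s' s & tiles pattern3 [::] [::] s'.
Proof.
(* [K] collects the possible partners of triangles, [L] the lengths 4 and 6, which are tiled
   alone. *)
move=> s2 le3; pose K := [seq m <- s | (m == 5) || (6 < m)].
pose L := [seq m <- s | (m == 4) || (m == 6)].
have KL : perm_eq (nseq (count_mem 3 s) 3 ++ K ++ L) s.
  apply/permP => a; rewrite !count_cat /K /L {le3}.
  elim: s s2 {K L} => //= m s IHs /andP[m2 /IHs {IHs}]; rewrite !count_nseq.
  by case: m m2 => [|[|[|[|[|[|[|m]]]]]]] //= _; rewrite ?mulnS; lia.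
have sizeK : count_mem 3 s <= size K.
  rewrite size_filter; apply: leq_trans le3 _; rewrite -count_predUI.
  by rewrite [X in _ + X](eq_count (a2 := pred0)) ?count_pred0 ?addn0 // => m /=; lia.
have tL : tiles pattern3 [::] [::] L.
  by apply: tiles_singletons => m; rewrite mem_filter => mL; apply: (@tiles3_cycle m); lia.
suff [s' s'K ts'] : exists2 s', perm_eq s' (nseq (count_mem 3 s) 3 ++ K)
                     & tiles pattern3 [::] [::] s'.
  exists (s' ++ L); last exact: tiles_cat.
  by apply: perm_trans KL; rewrite catA perm_cat2r.
have Kok m : m \in K -> (m == 5) || (6 < m) by rewrite mem_filter => /andP[].
(* Each triangle takes a partner from [K]; what remains of [K] is tiled by single cycles. *)
elim: K (count_mem 3 s) Kok sizeK {KL} => [|m K IHK] [|n] Kok //= szK.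
- by exists [::]; last exact: tiles_nil.
- exists (m :: K) => //; apply: tiles_singletons => k /Kok kK.
  by apply: (@tiles3_cycle k); lia.
have [|s' s'K ts'] := IHK n _ szK; first by move=> k kK; apply: Kok; rewrite inE kK orbT.
exists ([:: 3; m] ++ s'); last first.
  by apply: tiles_cat => //; apply: (@tiles3_3_cycle m); apply: Kok; rewrite mem_head.
by rewrite /= perm_cons perm_sym -[m :: K]cat1s perm_catCA /= perm_cons perm_sym.
Qed.

Lemma tiles4_tail q3 q4 L : all (fun m => 4 < m) L ->
  tiles pattern4 [::] [::] (nseq (3 * q3) 3 ++ nseq (2 * q4) 4 ++ L).
Proof.
move=> /allP L4; apply: tiles_cat; first exact: (@tiles_nseq _ 3 q3 3 tiles4_333).
apply: tiles_cat; first exact: (@tiles_nseq _ 2 q4 4 tiles4_44).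
by apply: tiles_singletons => m /L4 m4; apply: (@tiles4_cycle m).
Qed.

(** The block that may be traded comes first, with the remainders [a] and [b]; triples of triangles,
    pairs of 4-cycles and the other long cycles follow. *)
Lemma ex_tiles4_head R R' i j a b L L' : all (fun m => 4 < m) L' ->
  tiles pattern4 R R' (nseq a 3 ++ nseq b 4 ++ L) ->
  exists2 s', perm_eq s' (nseq (3 * i + a) 3 ++ nseq (2 * j + b) 4 ++ L ++ L')
    & tiles pattern4 R R' s'.
Proof.
move=> L'4 tK; have tT := tiles4_tail i j L'4.
exists ((nseq a 3 ++ nseq b 4 ++ L) ++ (nseq (3 * i) 3 ++ nseq (2 * j) 4 ++ L')).
  by apply/permP => c; rewrite !count_cat !count_nseq !mulnDr; lia.
exact: tiles_cat tK tT.
Qed.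

Definition tiles4_counts R R' a b L : Prop :=
  exists2 s', perm_eq s' (nseq a 3 ++ nseq b 4 ++ L) & tiles pattern4 R R' s'.

(** The parity of the number of 4-cycles and the number of triangles modulo 3 select the first
    block. The conditions on the sum exclude the cases in which the remainder has nothing to be
    combined with. *)
Lemma ex_tiles4 s : all (fun m => 2 < m) s -> odd (sumn s) -> ~~ (3 %| sumn s) ->
  exists2 s', perm_eq s' s
    & tiles pattern4 [::] [::] s' \/ tiles pattern4 trade_out trade_in s'.
Proof.
move=> s2 odd_s n3s; have sE := perm_lengths s2.
have sumE := perm_sumn sE; move: sumE odd_s n3s sE.
have L4 : all (fun m => 4 < m) [seq m <- s | 4 < m] by apply: filter_all.
move: (count_mem 3 s) (count_mem 4 s) [seq m <- s | 4 < m] L4 => a b L L4 -> odd_s n3s sE.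
suff [s' s'E ts'] : exists2 s', perm_eq s' (nseq a 3 ++ nseq b 4 ++ L)
    & tiles pattern4 [::] [::] s' \/ tiles pattern4 trade_out trade_in s'.
  by exists s' => //; apply: perm_trans s'E _; rewrite perm_sym.
rewrite !sumn_cat !sumn_nseq in odd_s n3s.
suff [[s' s'E ts']|[s' s'E ts']] :
    tiles4_counts [::] [::] a b L \/ tiles4_counts trade_out trade_in a b L.
- by exists s' => //; left.
- by exists s' => //; right.
have headP R R' i j a' b' K L' : a = 3 * i + a' -> b = 2 * j + b' -> L = K ++ L' ->
    tiles pattern4 R R' (nseq a' 3 ++ nseq b' 4 ++ K) ->
    tiles4_counts R R' a b L.
  move=> aE bE LE tK; rewrite /tiles4_counts aE bE LE; apply: ex_tiles4_head tK.
  by move: L4; rewrite LE all_cat => /andP[].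
have [bodd|beven] := boolP (odd b).
  have bE : b = 2 * (b %/ 2) + 1 by lia.
  case: (posnP a) => [a0|a0].
    (* With 4-cycles only, the order would be even. *)
    case: L L4 odd_s n3s sE headP => [|m L] /= L4 odd_s n3s sE headP; first by lia.
    case/andP: L4 => m4 L4; have [m5|m5] := eqVneq m 5.
      by right; apply: (headP _ _ 0 (b %/ 2) 0 1 [:: m] L) => //; rewrite m5; exact: tiles4_trade_45.
    left; apply: (headP _ _ 0 (b %/ 2) 0 1 [:: m] L) => //; apply: (@tiles4_4_cycle m); lia.
  (* If 3 divides [a], a full triple of triangles is set aside to accompany the odd 4-cycle. *)
  right; have [aE|[aE|aE]] : a = 3 * (a %/ 3) + 1 \/ a = 3 * (a %/ 3) + 2
     \/ a = 3 * (a %/ 3).-1 + 3 by lia.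
  - exact: (headP _ _ _ _ _ _ [::] L aE bE erefl) tiles4_trade_34.
  - exact: (headP _ _ _ _ _ _ [::] L aE bE erefl) tiles4_trade_334.
  - exact: (headP _ _ _ _ _ _ [::] L aE bE erefl) tiles4_trade_3334.
left; have bE : b = 2 * (b %/ 2) + 0 by lia.
have [aE|[aE|aE]] : a = 3 * (a %/ 3) + 0 \/ a = 3 * (a %/ 3) + 1 \/ a = 3 * (a %/ 3) + 2 by lia.
- exact: (headP _ _ _ _ _ _ [::] L aE bE erefl) (tiles_nil _).
- case: L L4 odd_s n3s sE headP => [|m L] /= L4 odd_s n3s sE headP.
    (* Without longer cycles the order is [3 a + 4 b]; it is not divisible by 3, so [b] is
       positive. *)
    have b2 : b = 2 * (b %/ 2).-1 + 2 by lia.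
    exact: (headP _ _ _ _ _ _ [::] [::] aE b2 erefl) tiles4_344.
  case/andP: L4 => m4 L4.
  by apply: (headP _ _ _ _ _ _ [:: m] L aE bE erefl); apply: (@tiles4_3_cycle m).
- case: L L4 odd_s n3s sE headP => [|m L] /= L4 odd_s n3s sE headP.
    have b2 : b = 2 * (b %/ 2).-1 + 2 by lia.
    exact: (headP _ _ _ _ _ _ [::] [::] aE b2 erefl) tiles4_3344.
  case/andP: L4 => m4 L4.
  by apply: (headP _ _ _ _ _ _ [:: m] L aE bE erefl); apply: (@tiles4_33_cycle m).
Qed.

(** Allows the cycles of [F] to be listed in the order in which their lengths are tiled. *)
Lemma ex_map_perm (T : eqType) (U : eqType) (f : T -> U) s t :
  perm_eq t (map f s) -> exists2 s', perm_eq s' s & map f s' = t.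
Proof.
elim: t s => [|y t IHt] s tE.
  by exists [::]; case: s tE => // x s /perm_size.
have /mapP[x xs yE] : y \in map f s by rewrite -(perm_mem tE) mem_head.
have sE := perm_to_rem xs.
have [|s' s'E <-] := IHt (rem x s).
  by rewrite -(perm_cons y) {2}yE -map_cons; apply: perm_trans tE (perm_map f sE).
exists (x :: s'); last by rewrite yE.
by rewrite perm_sym; apply: perm_trans sE _; rewrite perm_cons perm_sym.
Qed.

Lemma cycle_system_perm F (cs cs' : seq (seq (vert F))) :
  perm_eq cs' cs -> cycle_system cs -> cycle_system cs'.
Proof.
move=> pcs [ucs allcs ecs].
have fE : perm_eq (flatten cs') (flatten cs) by apply: perm_flatten.
split; first by rewrite (perm_uniq fE).
  by move=> v; rewrite (perm_mem fE).
apply: perm_trans ecs _; apply: perm_map; rewrite perm_sym.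
by apply: perm_flatten; apply: perm_map.
Qed.

Lemma covers_tiles p F (cs : seq (seq (vert F))) X R R' s :
  prime p -> odd p -> cycle_system cs -> sumn (map size cs) = p ->
  perm_eq s (map size cs) -> tiles X R R' s -> neutral p R R' ->
  all (fun w => ~~ (p %| w)) (pdiffs X) -> covers F 'F_p (size (pdiffs X)).
Proof.
move=> p_pr p_odd csP szcs sE [B blB] RR' Dp.
have [cs' cs'E s'E] := ex_map_perm sE; subst s.
apply: (covers_block p_pr p_odd (cycle_system_perm cs'E csP) blB) => //.
by rewrite -szcs; apply: perm_sumn.
Qed.

Lemma covers_mul F W l n : covers F W l -> covers F W (n * l).
Proof.
move=> cl; elim: n => [|n IHn]; last by rewrite mulSn; apply: covers_add.
exists void, (fun j : void => match j with end); split=> [[]|a b _].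
by rewrite big1 // => -[].
Qed.

(** Serves [p = 3], where the difference 3 vanishes: there [F] is a triangle, and one copy of it is
    [K_3]. *)
Lemma covers_triangle F (cs : seq (seq (vert F))) :
  cycle_system cs -> map size cs = [:: 3] -> covers F 'I_3 1.
Proof.
move=> csP szE; have [x [y [z csE]]] : exists x y z, cs = [:: [:: x; y; z]].
  by case: cs szE {csP} => [|[|x [|y [|z [|t c]]]] [|c' cs]] // _; exists x, y, z.
subst cs; have [/= ucs incs _] := csP; move: ucs; rewrite !inE !negb_or => /and3P[/andP[xy xz] yz _].
exists unit, (fun _ v => inord (index v [:: x; y; z])); split=> [_ v w|a b ab].
  have lt3 u : index u [:: x; y; z] < 3 by have := incs u; rewrite -index_mem.
  move/(congr1 (@nat_of_ord _));
  by rewrite !inordK //; apply: (index_inj x); exact: incs.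
rewrite (big_pred1 tt) /=; last by case.
rewrite (card_edges_image _ _ csP) /= /cycles_edges /cycle_edges /=.
rewrite !eqxx (negPf xy) (negPf xz) (negPf yz) /= !set2_eq //.
rewrite -!(inj_eq val_inj) /= !inordK //.
by move: ab; rewrite -(inj_eq val_inj) /=; case: a => [[|[|[|a]]] ?]; case: b => [[|[|[|b]]] ?].
Qed.

Lemma sum_count_mem n s :
  \sum_(7 <= i < n) count_mem i s <= count (fun m => 6 < m) s.
Proof.
elim: s => [|m s IHs] /=; first by rewrite big1.
rewrite big_split leq_add //= (eq_bigr (fun i => nat_of_bool (pred1 m i))); last first.
  by move=> i _; rewrite /= eq_sym.
rewrite -count_sum count_uniq_mem ?iota_uniq // mem_index_iota.
by case: (6 < m); case: (m < n).
Qed.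

Lemma covers_factorisation p F lam :
  prime p -> graph_order F = p -> covers F 'F_p lam ->
  has_factorisation (complete_mgraph lam p) F.
Proof.
move=> p_pr ordF cov; apply: factorisation_of_covers => //.
apply: (covers_bij (phi := cast_ord (Fp_cast p_pr))) cov.
by exists (cast_ord (esym (Fp_cast p_pr))); [exact: cast_ordK | exact: cast_ordKV].
Qed.

Theorem theorem33 (p : nat) (F : mgraph) :
  prime p -> odd p ->
  simple_graph F -> regular_graph 2 F -> graph_order F = p ->
  (forall lam : nat, 1 <= lam -> lam = 0 %[mod 4] ->
     has_factorisation (complete_mgraph lam p) F) /\
  (nu 3 F <= nu 5 F + \sum_(7 <= i < p.+1) nu i F ->
     forall lam : nat, lam = 3 \/ 6 <= lam ->
       has_factorisation (complete_mgraph lam p) F).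
Proof.
move=> p_pr p_odd simF regF ordF.
have [cs [csP cs2 nuE]] := ex_cycle_system simF regF.
have szcs : sumn (map size cs) = p.
  case: (csP) => ucs incs _; rewrite -ordF /graph_order -[LHS]size_flatten -(card_uniqP ucs).
  by apply: eq_card => v; rewrite incs.
have sz2 : all (fun m => 2 < m) (map size cs) by rewrite all_map.
have [p3|p3] := eqVneq p 3.
  have szE : map size cs = [:: 3].
    move: sz2 szcs; rewrite p3; case: (map size cs) => [|m [|m' s]] //=.
      by move=> _; rewrite addn0 => ->.
    by case/and3P=> m2 m2' _; lia.
  have cov lam : has_factorisation (complete_mgraph lam p) F.
    rewrite p3 in ordF *; apply: factorisation_of_covers => //.
    by rewrite -[lam]muln1; apply: covers_mul; apply: covers_triangle szE.
  by split=> [lam _ _|_ lam _]; exact: cov.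
have p5 : 4 < p.
  by move: p_pr p_odd p3; case: (p) => [|[|[|[|[|]]]]].
have Dp w : 0 < w -> w < 5 -> ~~ (p %| w).
  by move=> w0 w5; apply/negP => /(dvdn_leq w0); lia.
have cov4 : covers F 'F_p 4.
  have [||s' s'E] := ex_tiles4 sz2; rewrite ?szcs //.
    by rewrite dvdn_prime2 // eq_sym.
  have Dp4 : all (fun w => ~~ (p %| w)) (pdiffs pattern4) by rewrite /= !Dp.
  case=> ts'.
    exact: (covers_tiles p_pr p_odd csP szcs s'E ts' (@neutral_nil p) Dp4).
  exact: (covers_tiles p_pr p_odd csP szcs s'E ts' (neutral_trade p_pr p_odd) Dp4).
split=> [lam _ lam4|nu3].
  have -> : lam = lam %/ 4 * 4 by lia.
  by apply: covers_factorisation => //; apply: covers_mul.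
have cov3 : covers F 'F_p 3.
  have [|s' s'E ts'] := ex_tiles3 sz2.
    rewrite !count_map -(nuE 3) // -(nuE 5) //; apply: leq_trans nu3 _.
    rewrite leq_add2l (eq_big_nat _ _ (F2 := fun i => count_mem i (map size cs))).
      by apply: leq_trans (sum_count_mem _ _) _; rewrite count_map.
    by move=> i /andP[i7 _]; rewrite count_map nuE //; apply: leq_trans i7.
  have Dp3 : all (fun w => ~~ (p %| w)) (pdiffs pattern3) by rewrite /= !Dp.
  exact: (covers_tiles p_pr p_odd csP szcs s'E ts' (@neutral_nil p) Dp3).
move=> lam lamE; apply: covers_factorisation => //.
(* Since 4 is 1 modulo 3, the residue of [lam] modulo 3 serves as [y]; for 3 and from 6 on, [lam] is
   at least [4 y]. *)
have [x [y ->]] : exists x y, lam = x * 3 + y * 4.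
  have [r|[r|r]] : lam %% 3 = 0 \/ lam %% 3 = 1 \/ lam %% 3 = 2 by lia.
  - by exists (lam %/ 3), 0; lia.
  - by exists ((lam - 4) %/ 3), 1; lia.
  - by exists ((lam - 8) %/ 3), 2; lia.
by apply: covers_add; apply: covers_mul.
Qed.
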